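(* The action of the adjoint of the scaled forward operator $\frac{1}{a_R}\mathcal{A}_r^{\{N,D\}}$ (Neumann type $N$, respectively Dirichlet type $D$) on any scaled measured boundary data $\frac{1}{a_R}y^{\{N,D\}}_{r,e}\in C_0^\infty(\partial\Omega\times[0,T])$ is given by $$\left(\tfrac{1}{a_R}\mathcal{A}_r^{\{N,D\}}\right)^*\left[\tfrac{1}{a_R}y^{\{N,D\}}_{r,e}\right](x',t')=p^*_{e,r}(x',T-t'),$$ where $p^*_{e,r}$ is the free space-time adjoint wavefield associated with emitter $e$ and receiver $r$, and is the solution to the adjoint wave equation $$\left[\frac{1}{c^2}\frac{\partial^2}{\partial t'^2}-\rho_0\nabla_{x'}\cdot\left(\frac{1}{\rho_0}\nabla_{x'}\right)\right]p^*_{e,r}(x',t')=(\mathcal{S}^* )^{\{N,D\}}_{e,r}(x',T-t')$$ with Cauchy conditions $$p^*_{e,r}(x',0)=0,\qquad\frac{\partial}{\partial t'}p^*_{e,r}(x',0)=0,\qquad x'\in\mathbb{R}^d.$$ Here the Neumann-type and Dirichlet-type regularized adjoint sources are, respectively, $$(\mathcal{S}^* )^{N}_{e,r}(x',t')=\frac12\int_{\partial\nu_r\cap\partial\Omega}dS(x_s)\;\nabla\cdot\left(\frac{1}{\rho_0(x')}\nabla\big(\rho_0(x')\,\delta_b(x'-x_s)\big)\right)y^N_{r,e}(x_s,t'),$$ $$(\mathcal{S}^* )^{D}_{e,r}(x',t')=\frac12\int_{\partial\nu_r\cap\partial\Omega}dS(x_s)\;\nabla\delta_b(x'-x_s)\cdot\big[y^D_{r,e}(x_s,t')\,n_{r,-}\big],$$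 where $\nabla$ acts on $x'$. This is the adjoint corresponding to a single receiver $r$; the full adjoint operator $\left(\frac{1}{a_R}\mathcal{A}^{\{N,D\}}\right)^*$ is obtained by summing over all receivers $r$ in the adjoint source formula, which yields $\sum_r(\mathcal{S}^* )^{\{N,D\}}_{e,r}$.
   Context: Let $d\in\{2,3\}$ and $T>0$. $c$ is the velocity of wave propagation and $\rho_0=\rho_0(x)$ the ambient density of the medium. $\Omega\subset\mathbb{R}^d$ is an open domain with boundary $\partial\Omega$. Each receiver $r$ has an associated infinite plane $\partial\nu_r$, which splits space into a half-space $\nu_r^+$ containing $\Omega$ and the complementary half-space $\nu_r^-$. The receiver surface is the finite-sized subsurface $\partial\nu_r\cap\partial\Omega$ (often disk-shaped), with surface element $dS$. The outward-pointing unit normal $n_{r,+}$ is directed toward $\nu_r^-$, and $n_{r,-}=-n_{r,+}$ is the inward-pointing one. The index $e$ labels emitters. $\mathbb{R}^+$ is the positive time axis, and $C_0^\infty$ denotes smooth compactly supported functions. Regularized Dirac delta with bandwidth parameter $b>0$: $\delta_b(x-x')=\prod_{\zeta=1}^d\frac1b\,\mathrm{sinc}\!\left(\frac{\pi(x^\zeta-x'^\zeta)}{b}\right)$, where $x^\zeta$ is the $\zeta$-th Cartesian coordinate of $x$ and $\mathrm{sinc}(u)=\sin(u)/u$, $\mathrm{sinc}(0)=1$. Wave propagation operator: $\mathcal{P}:C_0^\infty(\mathbb{R}^d\times\mathbb{R}^+)\to C_0^\infty(\mathbb{R}^d\times[0,T])$, where $\mathcal{P}[\mathcal{S}]$ is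 the causal solution $p$ of $\frac{1}{c^2}\frac{\partial^2p}{\partial t^2}=\rho_0\nabla\cdot\left(\frac{1}{\rho_0}\nabla p\right)+\mathcal{S}$ (with $p=\partial_tp=0$ at $t=0$). Reception operators: $\mathcal{R}^{\{N,D\}}_{\mathcal{G},r}=\mathcal{R}_r\circ\mathcal{G}^{\{N,D\}}_r$ with $\mathcal{G}^N_r[f]=\rho_0\nabla\cdot\left(\frac{1}{\rho_0}\nabla f\right)$, $\mathcal{G}^D_r[f]=\frac{\partial f}{\partial n_{r,+}}$, and $$\mathcal{R}_r[h](x_s,t)=\frac12\int_{\mathbb{R}^d}dx\;\delta_{b,\partial\nu_r}(x_s-x)\,h(x,t)\quad\text{for }(x_s,t)\in(\partial\nu_r\cap\partial\Omega)\times[0,T],$$ and $0$ otherwise. Here $\delta_{b,\partial\nu_r}(x_s-x)=a_R(x_s)\,\delta_b(x_s-x)$ and $a_R(x_s)=\frac{dx_s}{dS(x_s)}$, which equals $b$ if one Cartesian coordinate coincides with the normal direction to the receiver surface. Forward operator: $\mathcal{A}_r^{\{N,D\}}=\mathcal{R}^{\{N,D\}}_{\mathcal{G},r}\circ\mathcal{P}:C_0^\infty(\mathbb{R}^d\times\mathbb{R}^+)\to C_0^\infty(\partial\Omega\times[0,T])$. It maps the regularized source $\mathcal{S}_e$ of emitter $e$, which generates the pressure field $p_e$, to the measured data $y^{\{N,D\}}_{r,e}$. On $(\partial\nu_r\cap\partial\Omega)\times[0,T]$ these data are $y^N_{r,e}=\frac{\partial p_e}{\partial n_{r,+}}$ and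 $y^D_{r,e}=p_e$, and they are $0$ otherwise. In the scaled operator $\frac{1}{a_R}\mathcal{A}_r^{\{N,D\}}$ the factor $a_R$ in the surface-restricted delta is cancelled. The adjoint of the scaled forward operator is the composition $\mathcal{P}^*\left(\frac{1}{a_R}\mathcal{R}^{\{N,D\}}_{\mathcal{G},r}\right)^*$. The adjoints of the constituents are taken with respect to the standard $L^2$ bilinear forms in $C_0^\infty(\mathbb{R}^d\times\mathbb{R}^+)$, $C_0^\infty(\mathbb{R}^d\times[0,T])$ and $C_0^\infty(\partial\Omega\times[0,T])$, the boundary integral over $\partial\nu_r\cap\partial\Omega$ being written with $dx_s$, related to $dS(x_s)$ by $a_R=dx_s/dS$.
   Formalization: With standard L² forms the claim fails for nonconstant ρ0, so it is proved in those forms for constant ρ0 only; for variable ρ0 the adjoint of P is taken in the forms weighted by 1/ρ0 and composed with the standard L² adjoint of the reception operator. *)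

(* Defs.v *)
From HB Require Import structures.
From mathcomp Require Import all_boot all_order all_algebra.
From mathcomp Require Import all_classical all_reals all_analysis.

Set Implicit Arguments.
Unset Strict Implicit.
Unset Printing Implicit Defensive.

Import Order.TTheory GRing.Theory Num.Theory.
Import numFieldNormedType.Exports.

Local Open Scope classical_set_scope.
Local Open Scope ring_scope.

Section Regularity.
Context {R : realType} {V : normedModType R}.

Definition iter_derive (f : V -> R) (vs : seq V) : V -> R :=
  foldr (fun v g x => 'D_v g x) f vs.

(* On the finite-dimensional spaces used below, existence and continuity of all
   iterated directional derivatives of order <= k is the usual class C^k. *)
Definition Ck (k : nat) (f : V -> R) : Prop :=
  forall vs : seq V, (size vs <= k)%N ->
    continuous (iter_derive f vs) /\
    ((size vs < k)%N -> forall x v, derivable (iter_derive f vs) x v).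

Definition smooth (f : V -> R) : Prop := forall k, Ck k f.

End Regularity.

(* Fields f(x, t) are curried; f is regular if (x, t) |-> f x t is.
   Functions on R^d x [0, T] (smooth up to t = 0 and t = T) are represented by
   functions on R^d x R of which only the values on [0, T] are used: a time
   derivative at an endpoint is then the one-sided one. *)
Notation field R d := ('rV[R]_d -> R -> R).

Section Fields.
Context {R : realType} {d : nat}.
Implicit Types (f S : field R d) (T : R).

Definition on_pairs f : 'rV[R]_d * R -> R := fun z => f z.1 z.2.

Definition C0infty f : Prop :=
  smooth (on_pairs f) /\
  exists2 K : set ('rV[R]_d * R), compact K &
    forall x t, ~ K (x, t) -> f x t = 0.

(* C_0^oo(R^d x R^+): the compact support lies in the open set t > 0 *)
Definition C0infty_pos S : Prop :=
  smooth (on_pairs S) /\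
  exists2 K : set ('rV[R]_d * R), compact K &
    (forall x t, K (x, t) -> 0 < t) /\
    (forall x t, ~ K (x, t) -> S x t = 0).

Definition continuous_on_times (I : set R) f : Prop :=
  {within [set z : 'rV[R]_d * R | I z.2], continuous (on_pairs f)}.

End Fields.

Section Operators.
Context {R : realType} {d : nat}.
Implicit Types (rho u : 'rV[R]_d -> R).

Definition dot (u v : 'rV[R]_d) : R := \sum_i u 0 i * v 0 i.

Definition grad u (x : 'rV[R]_d) : 'rV[R]_d :=
  \row_i 'D_(delta_mx 0 i) u x.

Definition divg (F : 'rV[R]_d -> 'rV[R]_d) (x : 'rV[R]_d) : R :=
  \sum_i 'D_(delta_mx 0 i) (fun z => F z 0 i) x.

(* nabla . ((1 / rho) nabla u) *)
Definition div_grad_inv rho u : 'rV[R]_d -> R :=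
  divg (fun z => (rho z)^-1 *: grad u z).

End Operators.

(* The Lebesgue integral over R^n as an iterated one-dimensional Lebesgue
   integral (Fubini); every integrand below to which it is applied is absolutely
   integrable. *)
Fixpoint integral_Rn {R : realType} (n : nat) : ('rV[R]_n -> R) -> R :=
  match n with
  | 0%N => fun f => f 0
  | n'.+1 => fun f =>
      \int[@lebesgue_measure R]_s
        integral_Rn (fun u : 'rV[R]_n' => f (row_mx s%:M u : 'rV[R]_(1 + n')))
  end.

(* \int_I \int_{R^d} f g w dx dt; the standard L^2 form is the case w = 1 *)
Definition st_form {R : realType} {d : nat} (w : 'rV[R]_d -> R) (I : set R)
    (f g : field R d) : R :=
  \int[@lebesgue_measure R]_(t in I)
    integral_Rn (fun x => f x t * g x t * w x).

Section Delta.
Context {R : realType} {d : nat}.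

Definition sinc (u : R) : R := if u == 0 then 1 else sin u / u.

Definition delta (b : R) (z : 'rV[R]_d) : R :=
  \prod_i (b^-1 * sinc (pi * z 0 i / b)).

End Delta.

(* A receiver: a point and the unit normal n_{r,+} of its plane, an orthonormal
   frame (the rows) of the directions of that plane, and the density
   a_R = dx_s / dS. The frame only serves to integrate over the plane; the
   integral does not depend on its choice. *)
Record receiver (R : realType) (d : nat) := Receiver {
  rc_point : 'rV[R]_d;
  rc_normal : 'rV[R]_d;
  rc_frame : 'M[R]_(d.-1, d);
  rc_a : 'rV[R]_d -> R }.

Section Receivers.
Context {R : realType} {d : nat}.
Implicit Types (Omega : set 'rV[R]_d) (r : receiver R d).

Definition bdry Omega : set 'rV[R]_d := closure Omega `\` interior Omega.

Definition plane r : set 'rV[R]_d :=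
  [set x | dot (x - rc_point r) (rc_normal r) = 0].

(* nu_r^+; the normal n_{r,+} points out of it *)
Definition half_space_pos r : set 'rV[R]_d :=
  [set x | dot (x - rc_point r) (rc_normal r) < 0].

Definition rc_surface Omega r : set 'rV[R]_d := plane r `&` bdry Omega.

Definition is_receiver (b : R) Omega r : Prop :=
  [/\ dot (rc_normal r) (rc_normal r) = 1,
      rc_frame r *m (rc_frame r)^T = 1%:M /\
        rc_frame r *m (rc_normal r)^T = 0,
      Omega `<=` half_space_pos r,
      bounded_set (rc_surface Omega r) &
      [/\ {within rc_surface Omega r, continuous (rc_a r)},
          forall x, rc_surface Omega r x -> 0 < rc_a r x &
          forall i : 'I_d,
            rc_normal r = delta_mx 0 i \/ rc_normal r = - delta_mx 0 i ->
            forall x, rc_surface Omega r x -> rc_a r x = b]].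

(* \int_{surface} phi dS, with dS the (d-1)-dimensional Lebesgue measure of the
   plane in the orthonormal coordinates of the frame *)
Definition surface_integral Omega r (phi : 'rV[R]_d -> R) : R :=
  integral_Rn (fun u : 'rV[R]_(d.-1) =>
    let x := rc_point r + u *m rc_frame r in
    phi x * \1_(rc_surface Omega r) x).

(* \int_0^T \int_{surface} f g dx_s dt, where dx_s = a_R dS *)
Definition bd_form (T : R) Omega r (f g : field R d) : R :=
  \int[@lebesgue_measure R]_(t in `[0, T])
    surface_integral Omega r (fun x => f x t * g x t * rc_a r x).

(* g \in C_0^oo(boundary of Omega x [0, T]) *)
Definition C0infty_bdry (T : R) Omega (g : field R d) : Prop :=
  exists2 G : field R d, C0infty G &
    forall x t, bdry Omega x -> 0 <= t <= T -> g x t = G x t.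

Definition scale_inv r (f : field R d) : field R d :=
  fun x t => (rc_a r x)^-1 * f x t.

End Receivers.

Section Wave.
Context {R : realType} {d : nat}.
Implicit Types (c rho : 'rV[R]_d -> R) (f p S : field R d) (T b : R).

Definition wave_op c rho p : field R d := fun x t =>
  (c x ^+ 2)^-1 * derive1n 2 (p x) t
  - rho x * div_grad_inv rho (fun z => p z t) x.

Definition cauchy0 p : Prop :=
  forall x, p x 0 = 0 /\ derive1 (p x) 0 = 0.

Definition is_propagation c rho T (P : field R d -> field R d) : Prop :=
  forall S, C0infty_pos S ->
    [/\ C0infty (P S),
        forall x t, 0 <= t <= T -> wave_op c rho (P S) x t = S x t &
        cauchy0 (P S)].

Inductive bc_type := Neumann | Dirichlet.

Definition G_op (k : bc_type) rho (r : receiver R d) f : field R d :=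
  match k with
  | Neumann => fun x t => rho x * div_grad_inv rho (fun z => f z t) x
  | Dirichlet => fun x t => 'D_(rc_normal r) (fun z => f z t) x
  end.

Definition R_op b T (Omega : set 'rV[R]_d) (r : receiver R d) f : field R d :=
  fun xs t =>
    if `[< rc_surface Omega r xs /\ 0 <= t <= T >] then
      2^-1 * integral_Rn (fun x => rc_a r xs * delta b (xs - x) * f x t)
    else 0.

Definition RG_op k rho b T Omega r f : field R d :=
  R_op b T Omega r (G_op k rho r f).

Definition adjoint_source (k : bc_type) rho b (Omega : set 'rV[R]_d)
    (r : receiver R d) (y : field R d) : field R d :=
  match k with
  | Neumann => fun x t => 2^-1 * surface_integral Omega r (fun xs =>
      div_grad_inv rho (fun z => rho z * delta b (z - xs)) x * y xs t)
  | Dirichlet => fun x t => 2^-1 * surface_integral Omega r (fun xs =>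
      dot (grad (fun z => delta b (z - xs)) x) (y xs t *: - rc_normal r))
  end.

Definition adjoint_wavefield c rho T (src ps : field R d) : Prop :=
  [/\ Ck 2 (on_pairs ps),
      forall x t, 0 <= t <= T -> wave_op c rho ps x t = src x (T - t) &
      cauchy0 ps].

(* q(x', t') = ps(x', T - t') on R^d x [0, T]; for t' > T the argument T - t'
   precedes the start of ps, and q vanishes *)
Definition is_time_reversal T (ps q : field R d) : Prop :=
  forall x t, (0 <= t <= T -> q x t = ps x (T - t)) /\ (T < t -> q x t = 0).

End Wave.

Section Adjoint.
Context {R : realType} {d : nat}.
Implicit Types (c rho : 'rV[R]_d -> R) (q : field R d) (T b : R).
Implicit Types (P : field R d -> field R d) (Omega : set 'rV[R]_d).
Variable I : finType.
Implicit Types (r : I -> receiver R d) (y : I -> field R d) (A : {set I}).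

(* The operators below collect the receivers r i, i \in A: f is mapped to the
   family of its values at these receivers, and two such families are paired by
   the sum of the boundary forms. A single receiver is A = [set i]; the full
   operator is A = setT. *)
Definition scaled_pairing k rho b T Omega r A y (f : field R d) : R :=
  \sum_(i in A) bd_form T Omega (r i)
    (scale_inv (r i) (RG_op k rho b T Omega (r i) f))
    (scale_inv (r i) (y i)).

(* q is the image of ((1 / a_R) y i)_i under the adjoint of the scaled forward
   operator S |-> ((1 / a_R) RG_i (P S))_i, for the standard L^2 forms *)
Definition is_forward_adjoint k rho b T Omega P r A y q : Prop :=
  forall S, C0infty_pos S ->
    scaled_pairing k rho b T Omega r A y (P S) =
    st_form (cst 1) `]0, +oo[ S q.

(* h is the image of ((1 / a_R) y i)_i under the adjoint of the scaled reception
   operator, for the standard L^2 forms *)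
Definition is_reception_adjoint k rho b T Omega r A y (h : field R d) : Prop :=
  forall f, C0infty f ->
    scaled_pairing k rho b T Omega r A y f = st_form (cst 1) `[0, T] f h.

(* q = P^*[h], for the forms with weight w *)
Definition is_propagation_adjoint (w : 'rV[R]_d -> R) T P (h q : field R d) :
    Prop :=
  forall S, C0infty_pos S ->
    st_form w `[0, T] (P S) h = st_form w `]0, +oo[ S q.

(* q = P^*[((1 / a_R) RG)^*[(1 / a_R) y]]; w is the weight of the forms for P *)
Definition is_composed_adjoint (w : 'rV[R]_d -> R) k rho b T Omega P r A y q :
    Prop :=
  exists h : field R d,
    [/\ continuous_on_times `[0, T] h,
        is_reception_adjoint k rho b T Omega r A y h &
        is_propagation_adjoint w T P h q].

Definition total_source k rho b Omega r y : field R d :=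
  fun x t => \sum_i adjoint_source k rho b Omega (r i) (y i) x t.

(* With the standard L^2 forms (w = 1) the adjoint of P is governed by the
   transpose v |-> nabla . ((1 / rho) nabla (rho v)) of the spatial operator
   u |-> rho nabla . ((1 / rho) nabla u); the two agree only for constant rho.
   The latter operator is symmetric for the forms of weight 1 / rho, which are
   therefore the ones used for P when rho varies. *)
Definition adjoint_action_formula k c rho b T Omega P r A y
    (src : field R d) : Prop :=
  forall ps : field R d, adjoint_wavefield c rho T src ps ->
  forall q : field R d, continuous_on_times `[0, +oo[ q ->
    (is_composed_adjoint (fun x => (rho x)^-1) k rho b T Omega P r A y q
       <-> is_time_reversal T ps q) /\
    ((forall x x', rho x = rho x') ->
       (is_forward_adjoint k rho b T Omega P r A y q
          <-> is_time_reversal T ps q) /\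
       (is_composed_adjoint (cst 1) k rho b T Omega P r A y q
          <-> is_time_reversal T ps q)).

End Adjoint.

(* Main.v *)
Require Import Defs.
From HB Require Import structures.
From mathcomp Require Import all_boot all_order all_algebra.
From mathcomp Require Import all_classical all_reals all_analysis.
From mathcomp Require Import measurable_realfun.
From mathcomp Require Import ring lra.

Import Order.TTheory GRing.Theory Num.Theory.
Import numFieldNormedType.Exports.

Local Open Scope classical_set_scope.
Local Open Scope ring_scope.

(** Two adjoints are computed separately and then composed.

    Reception.  In the pairing of the scaled data with the scaled reception of
    a field f, the factors a_R cancel: one comes from the restricted delta, one
    from dx_s = a_R dS, and the scalings divide by a_R twice.  What is left is
    integrated by parts in space, so that the differential operator leaves f
    and acts on the regularized delta, and the integral over the receiver
    surface is exchanged with the one over space.  The result is the pairing of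
    f with the adjoint source ([receiver_box_duality], [reception_duality]).

    Propagation.  Let p be the field propagated from S, ps the adjoint
    wavefield and w = kappa / rho a weight.  For this weight the operator
    u |-> rho nabla . ((1 / rho) nabla u) is symmetric.  The reversed field
    (x, t) |-> ps x (T - t) solves the wave equation with the adjoint source
    and, like its time derivative, vanishes at t = T, whereas p and its time
    derivative vanish at t = 0.  Green's identity in space and time therefore
    has no boundary terms, and the pairing of p with the adjoint source equals
    the pairing of S with the reversed field ([wave_reciprocity]).  Taking
    kappa = 1 gives the forms of weight 1 / rho; for constant rho, kappa = rho
    gives the standard forms.

    These two identities show that the reversed field is an adjoint image.
    Conversely an adjoint image that is continuous is determined by its
    pairings, because smooth bumps of small support separate continuous fields
    ([st_form_separates]).  This is used first for the intermediate field h,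
    which must be the adjoint source on [0, T], and then for q.

    All integrals are iterated one-dimensional ones, and their exchange does
    not go through product measures.  A positive linear functional L on the
    continuous functions of a compact set ([integral_on]) can be differentiated
    under its sign ([io_derive]), and so it commutes with an integral over
    [a, b]: as functions of b, both orders of integration are primitives of the
    same function ([io_fubini_interval]).  Integrals over intervals, boxes and
    receiver surfaces are such functionals.  For the surface, which is only a
    compact set, this follows by dominated convergence from cutoff functions
    that decrease to its indicator ([compact_integralP]). *)

(** * Continuity, and positive functionals on compact sets *)

Section Continuity.
Context {R : realType} {X Y Z : topologicalType}.

Lemma continuous_addf {f g : X -> R} : continuous f -> continuous g ->
  continuous (fun x => f x + g x).
Proof. by move=> cf cg x; apply: cvgD; [exact: cf|exact: cg]. Qed.

Lemma continuous_mulf {f g : X -> R} : continuous f -> continuous g ->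
  continuous (fun x => f x * g x).
Proof. by move=> cf cg x; apply: cvgM; [exact: cf|exact: cg]. Qed.

Lemma continuous_oppf {f : X -> R} : continuous f -> continuous (fun x => - f x).
Proof. by move=> cf x; apply: cvgN; exact: cf. Qed.

Lemma continuous_subf {f g : X -> R} : continuous f -> continuous g ->
  continuous (fun x => f x - g x).
Proof. by move=> cf cg x; apply: cvgB; [exact: cf|exact: cg]. Qed.

Lemma continuous_invf {f : X -> R} : (forall x, f x != 0) -> continuous f ->
  continuous (fun x => (f x)^-1).
Proof. by move=> f0 cf x; apply: cvgV => //; exact: cf. Qed.

Lemma continuous_cstf {Y' : topologicalType} (a : Y') : continuous (fun _ : X => a).
Proof. by move=> x; exact: cvg_cst. Qed.

Lemma continuous_compf {f : Y -> Z} {g : X -> Y} :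
  continuous f -> continuous g -> continuous (fun x => f (g x)).
Proof. by move=> cf cg x; apply: (continuous_comp (cg x)); exact: cf. Qed.

Lemma continuous_pairf {f : X -> Y} {g : X -> Z} :
  continuous f -> continuous g -> continuous (fun x => (f x, g x)).
Proof. by move=> cf cg x; apply: cvg_pair; [exact: cf|exact: cg]. Qed.

Lemma continuous_fstf {f : X -> Y * Z} : continuous f -> continuous (fun x => (f x).1).
Proof. by move=> cf x; apply: (continuous_comp (cf x)); exact: cvg_fst. Qed.

Lemma continuous_sndf {f : X -> Y * Z} : continuous f -> continuous (fun x => (f x).2).
Proof. by move=> cf x; apply: (continuous_comp (cf x)); exact: cvg_snd. Qed.

Lemma continuous_idf : continuous (fun x : X => x).
Proof. by move=> x; exact: cvg_id. Qed.

Lemma continuous_sumf {I : Type} {s : seq I} {f : I -> X -> R} :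
  (forall i, continuous (f i)) -> continuous (fun x => \sum_(i <- s) f i x).
Proof.
move=> cf; elim: s => [|i s IH].
  by under eq_fun do rewrite big_nil; exact: continuous_cstf.
by under eq_fun do rewrite big_cons; apply: continuous_addf.
Qed.

End Continuity.

Section Currying.
Context {X Y Z : topologicalType}.

(** The joint continuity of curried functions is always expressed on pairs;
    the lemmas of this section are its stability under substitution. *)
Lemma continuous_app2 {W : topologicalType} {f : X -> Y -> Z} {g : W -> X} {h : W ->
    Y} :
  continuous (fun z : X * Y => f z.1 z.2) -> continuous g -> continuous h ->
  continuous (fun w => f (g w) (h w)).
Proof.
move=> cf cg ch.
exact: (@continuous_compf _ _ _ (fun z : X * Y => f z.1 z.2)
   (fun w => (g w, h w)) cf (continuous_pairf cg ch)).
Qed.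

Lemma continuous_slicer {f : X -> Y -> Z} (x : X) :
  continuous (fun z : X * Y => f z.1 z.2) -> continuous (f x).
Proof.
by move=> cf; exact: (continuous_app2 cf (continuous_cstf x) (@continuous_idf Y)).
Qed.

Lemma continuous_slicel {f : X -> Y -> Z} (y : Y) :
  continuous (fun z : X * Y => f z.1 z.2) -> continuous (f ^~ y).
Proof.
by move=> cf; exact: (continuous_app2 cf (@continuous_idf X) (continuous_cstf y)).
Qed.

Lemma continuous_swapf {f : X -> Y -> Z} :
  continuous (fun z : X * Y => f z.1 z.2) -> continuous (fun z : Y * X => f z.2 z.1).
Proof.
move=> cf; apply: (continuous_app2 cf (continuous_sndf _) (continuous_fstf _));
  exact: continuous_idf.
Qed.
End Currying.

Section IntegralOn.
Context {R : realType}.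

(** A positive linear functional on the continuous functions of the compact
    set [K]. Functions are defined on the whole space, and [io_local] says
    that only their values on [K] count, also for functions that are not
    continuous. *)
Record integral_on {X : topologicalType} (K : set X) (L : (X -> R) -> R) : Prop :=
  IntegralOn {
  io_compact : compact K;
  io_local : forall f g : X -> R, (forall x, K x -> f x = g x) -> L f = L g;
  io_add : forall f g : X -> R, continuous f -> continuous g ->
    L (fun x => f x + g x) = L f + L g;
  io_scale : forall (a : R) (f : X -> R), continuous f -> L (fun x =>
      a * f x) = a * L f;
  io_ge0 : forall f : X -> R, continuous f -> (forall x, K x -> 0 <= f x) -> 0 <= L f }.

Arguments io_compact {X K L}.
Arguments io_local {X K L} _ {f g}.
Arguments io_add {X K L} _ {f g}.
Arguments io_scale {X K L} _ a {f}.
Arguments io_ge0 {X K L} _ {f}.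

Section Theory.
Context {X : topologicalType} {K : set X} {L : (X -> R) -> R}.
Hypothesis HL : integral_on K L.

Lemma io_opp {f : X -> R} : continuous f -> L (fun x => - f x) = - L f.
Proof.
move=> cf; rewrite -mulN1r -(io_scale HL)//.
by apply: (io_local HL) => x _; rewrite mulN1r.
Qed.

Lemma io_sub {f g : X -> R} : continuous f -> continuous g ->
  L (fun x => f x - g x) = L f - L g.
Proof.
by move=> cf cg; rewrite (io_add HL)// ?io_opp//; exact: continuous_oppf.
Qed.

Lemma io_eq0 {f : X -> R} : (forall x, K x -> f x = 0) -> L f = 0.
Proof.
move=> f0; rewrite (io_local HL (g := fun=> 0 * 0)); last first.
  by move=> x /f0; rewrite mul0r.
by rewrite (io_scale HL) ?mul0r//; exact: continuous_cstf.
Qed.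

Lemma io_scaler (a : R) {f : X -> R} : continuous f -> L (fun x => f x * a) = L f * a.
Proof.
move=> cf; rewrite mulrC -(io_scale HL)//; apply: (io_local HL) => x _.
by rewrite mulrC.
Qed.

Lemma io_sum {I : Type} {s : seq I} {f : I -> X -> R} :
  (forall i, continuous (f i)) ->
  L (fun x => \sum_(i <- s) f i x) = \sum_(i <- s) L (f i).
Proof.
move=> cf; elim: s => [|i s IH].
  by rewrite big_nil; apply: io_eq0 => x _; rewrite big_nil.
rewrite big_cons -IH -(io_add HL)//; last exact: continuous_sumf.
by apply: (io_local HL) => x _; rewrite big_cons.
Qed.

Lemma io_le {f g : X -> R} : continuous f -> continuous g -> (forall x, K x ->
    f x <= g x) ->
  L f <= L g.
Proof.
move=> cf cg fg; rewrite -subr_ge0 -io_sub//; apply: (io_ge0 HL).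
  exact: continuous_subf.
by move=> x Kx; rewrite subr_ge0 fg.
Qed.

(** Positivity gives boundedness, with the total mass [L 1] as constant. *)
Lemma io_bound {f : X -> R} {M : R} : continuous f -> (forall x, K x -> `|f x| <= M) ->
  `|L f| <= M * L (fun=> 1).
Proof.
move=> cf fM.
have c1 : continuous (fun _ : X => 1 : R) by exact: continuous_cstf.
have cM : continuous (fun _ : X => M * 1 : R) by exact: continuous_cstf.
rewrite -(io_scale HL)// ler_norml -io_opp//.
have fM' x : K x -> - (M * 1) <= f x /\ f x <= M * 1.
  by move=> /fM; rewrite mulr1 ler_norml => /andP[].
apply/andP; split; apply: io_le => //; try exact: continuous_oppf.
  by move=> x /fM'[].
by move=> x /fM'[].
Qed.

(** Compactness turns joint continuity into uniformity over [K]. *)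
Lemma near_uniform {U : topologicalType} {f : U -> X -> R} (u0 : U) {d : R} :
  0 < d -> continuous (fun z : U * X => f z.1 z.2) ->
  \forall u \near u0, forall x, K x -> `|f u0 x - f u x| <= d.
Proof.
move=> d0 cf; have /compact_near_coveringP := io_compact HL.
apply => x Kx.
have c0 : continuous (fun z : X * U => f u0 z.1 - f z.2 z.1).
  apply: continuous_subf; last exact: (continuous_swapf cf).
  apply: continuous_app2; [exact: cf|exact: continuous_cstf|].
  by apply: continuous_fstf; exact: continuous_idf.
have /cvgrPdist_le /(_ d d0) := c0 (x, u0).
by apply: filterS => -[x' u'] /=; rewrite subrr sub0r normrN.
Qed.

(** The variation of [f u] is uniformly small on [K], and [L] is bounded. *)
Lemma io_continuous {U : topologicalType} {f : U -> X -> R} :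
  continuous (fun z : U * X => f z.1 z.2) -> continuous (fun u => L (f u)).
Proof.
move=> cf u0; apply/cvgrPdist_le => e e0.
have L1 : 0 <= L (fun=> 1).
  by apply: (io_ge0 HL) => //; exact: continuous_cstf.
pose d := e / (L (fun=> 1) + 1).
have L10 : 0 < L (fun=> 1) + 1 by rewrite ltr_wpDl.
have d0 : 0 < d by rewrite divr_gt0.
have near_K := near_uniform u0 d0 cf.
near=> u; rewrite -io_sub//; try exact: continuous_slicer cf.
have -> : e = d * (L (fun=> 1) + 1) by rewrite /d divfK// gt_eqF.
apply: (@le_trans _ _ (d * L (fun=> 1))); last first.
  by rewrite ler_wpM2l ?(ltW d0)// lerDl.
apply: io_bound; last by near: u.
by apply: continuous_subf; exact: continuous_slicer cf.
Unshelve. all: by end_near. Qed.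

(** By the mean value theorem a difference quotient of [g] in [s] is a value
    of [g'] at a nearby parameter, hence uniformly close to [g' s0] on [K]. *)
Lemma io_derive {g g' : R -> X -> R} (s0 : R) :
  (\forall s \near s0, continuous (g s)) ->
  continuous (fun z : R * X => g' z.1 z.2) ->
  (\forall s \near s0, forall x, is_derive (s : R) (1 : R) (g ^~ x : R ->
      R) (g' s x)) ->
  is_derive s0 (1 : R) (fun s : R => L (g s)) (L (g' s0)).
Proof.
move=> cg cg' dg.
suff H : h^-1 *: (L (g (h *: 1 + s0)) - L (g s0)) @[h --> 0^'] --> L (g' s0).
  have D : derivable (fun s : R => L (g s)) s0 (1 : R) by apply/cvg_ex;
      exists (L (g' s0)).
  by split => //; apply: cvg_lim.
apply/cvgrPdist_le => e e0.
have L1 : 0 <= L (fun=> 1).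
  by apply: (io_ge0 HL) => //; exact: continuous_cstf.
pose d := e / (L (fun=> 1) + 1).
have L10 : 0 < L (fun=> 1) + 1 by rewrite ltr_wpDl.
have d0 : 0 < d by rewrite divr_gt0.
have near_K := near_uniform s0 d0 cg'.
have Hn : \forall s \near s0, [/\ continuous (g s),
    forall x, is_derive (s : R) (1 : R) (g ^~ x : R -> R) (g' s x) &
    forall x, K x -> `|g' s0 x - g' s x| <= d].
  by near=> s; split; near: s.
move/nbhs_ballP : Hn => [r /= r0 Hr].
near=> h.
have h0 : h != 0 by near: h; exact: nbhs_dnbhs_neq.
have hr : `|h| < r.
  near: h; apply: dnbhs0_lt => //.
have Hball s : `|s - s0| < r -> ball s0 r s by rewrite -ball_normE /= distrC.
have csh : continuous (g (h *: 1 + s0)).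
  by have [] := Hr _ (Hball (h *: 1 + s0) _); rewrite ?addrK ?[_ *: _]mulr1.
have cs0 : continuous (g s0) by have [] := Hr _ (ballxx s0 r0).
have cs0' : continuous (g' s0) by exact: continuous_slicer cg'.
have cd : continuous (fun x => g (h *: 1 + s0) x - g s0 x) by exact: continuous_subf.
rewrite -io_sub// -[_ *: _](io_scale HL)// -io_sub//; last first.
  by apply: continuous_mulf => //; exact: continuous_cstf.
have -> : e = d * (L (fun=> 1) + 1) by rewrite /d divfK// gt_eqF.
apply: (@le_trans _ _ (d * L (fun=> 1))); last first.
  by rewrite ler_wpM2l ?(ltW d0)// lerDl.
apply: io_bound.
  apply: continuous_subf => //.
  by apply: continuous_mulf => //; exact: continuous_cstf.
move=> x Kx; rewrite [_ *: 1]mulr1.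
have dgx s : `|s - s0| < r -> is_derive (s : R) (1 : R) (g ^~ x : R -> R) (g' s x).
  by move=> /Hball/Hr[].
have bg' s : `|s - s0| < r -> `|g' s0 x - g' s x| <= d.
  by move=> /Hball/Hr[_ _]; apply.
have cgx (a b : R) : `|a - s0| < r -> `|b - s0| < r ->
    {within `[a, b], continuous (g ^~ x)}.
  move=> ar br; apply: derivable_within_continuous => s.
  rewrite in_itv/= => /andP[as_ sb].
  have [] // := dgx s _.
  move: ar br; rewrite !ltr_norml => /andP[? ?] /andP[? ?].
  by apply/andP; split; lra.
have [hpos|hneg] := ltP 0 h.
- have [|||c] := @MVT R (g ^~ x) (g' ^~ x) s0 (h + s0); first by rewrite ltrDr.
  + move=> s; rewrite in_itv/= => /andP[s1 s2]; apply: dgx.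
    by move: hr; rewrite gtr0_norm// => hr; rewrite gtr0_norm ?subr_gt0//; lra.
  + by apply: cgx; rewrite ?addrK// subrr normr0.
  + rewrite in_itv/= => /andP[s1 s2] ->.
    rewrite addrK mulrC mulfK//; apply: bg'.
    by move: hr; rewrite gtr0_norm// => hr; rewrite gtr0_norm ?subr_gt0//; lra.
- have {}hneg : h < 0 by rewrite lt_neqAle h0.
  have [|||c] := @MVT R (g ^~ x) (g' ^~ x) (h + s0) s0; first by rewrite gtrDr.
  + move=> s; rewrite in_itv/= => /andP[s1 s2]; apply: dgx.
    by move: hr; rewrite ltr0_norm// => hr; rewrite ltr0_norm ?subr_lt0//; lra.
  + by apply: cgx; rewrite ?addrK// subrr normr0.
  + rewrite in_itv/= => /andP[s1 s2] gE.
    rewrite -(opprB (g s0 x)) gE (_ : h^-1 * _ = g' c x); last by field.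
    apply: bg'.
    by move: hr; rewrite ltr0_norm// => hr; rewrite ltr0_norm ?subr_lt0//; lra.
Unshelve. all: by end_near. Qed.

End Theory.


End IntegralOn.
Arguments io_compact {R X K L}.
Arguments io_local {R X K L} _ {f g}.
Arguments io_add {R X K L} _ {f g}.
Arguments io_scale {R X K L} _ a {f}.
Arguments io_ge0 {R X K L} _ {f}.

(** * The integral over an interval and its exchange with other functionals *)

Section Interval.
Context {R : realType}.
Notation mu := (@lebesgue_measure R).

Definition interval_integral (a b : R) (f : R -> R) : R :=
  \int[mu]_(x in `[a, b]) f x.

Lemma continuous_integrable (a b : R) {f : R -> R} : continuous f ->
  mu.-integrable `[a, b] (EFin \o f).
Proof.
move=> cf; apply: continuous_compact_integrable; first exact: segment_compact.
exact: continuous_subspaceT.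
Qed.

Lemma interval_integralP (a b : R) : @integral_on R R `[a, b] (interval_integral a b).
Proof.
split.
- exact: segment_compact.
- by move=> f g fg; apply: eq_Rintegral => x; rewrite inE => /fg.
- by move=> f g cf cg; rewrite /interval_integral RintegralD//;
    exact: continuous_integrable.
- by move=> r f cf; rewrite /interval_integral RintegralZl//;
    exact: continuous_integrable.
- by move=> f cf f0; exact: Rintegral_ge0.
Qed.

Lemma interval_integralxx (a : R) (f : R -> R) : interval_integral a a f = 0.
Proof. by rewrite /interval_integral set_itv1 Rintegral_set1. Qed.

(** The primitive is only required to be differentiable to the right of some
    point [a0] before [a], so that integrals from a fixed base point
    qualify. *)
Lemma interval_FTC2 {a0 a b : R} {F f : R -> R} : a0 < a -> a <= b ->
  continuous f -> (forall x : R, a0 < x -> is_derive x (1 : R) F (f x)) ->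
  interval_integral a b f = F b - F a.
Proof.
move=> a0a; rewrite le_eqVlt => /predU1P[<- _ _|ab cf dF].
  by rewrite interval_integralxx subrr.
have cF x : a0 < x -> {for x, continuous F}.
  by move=> /dF[dFx _]; apply: differentiable_continuous; exact/derivable1_diffP.
rewrite /interval_integral /Rintegral (@continuous_FTC2 _ f F a b)//.
- exact: continuous_subspaceT.
- split.
  + by move=> x; rewrite in_itv/= => /andP[ax xb]; have [] := dF x (lt_trans a0a ax).
  + by apply: cvg_at_right_filter; exact: cF.
  + by apply: cvg_at_left_filter; apply: cF; exact: lt_trans ab.
- move=> x; rewrite in_itv/= => /andP[ax xb].
  by rewrite derive1E; have [_ ->] := dF x (lt_trans a0a ax).
Qed.

Lemma is_derive_primitive {a0 s : R} {f : R -> R} : a0 < s -> continuous f ->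
  is_derive s (1 : R) (fun t => interval_integral a0 t f) (f s).
Proof.
move=> a0s cf.
have s1 : s < s + 1 by rewrite ltrDl.
have [d e] := @continuous_FTC1_closed R f a0 s (s + 1) s1
  (continuous_integrable a0 (s + 1) cf) a0s (cf s).
by rewrite derive1E in e; exact: (DeriveDef d e).
Qed.

(** Let [Phi s x] be the integral of [f t x] for t from [a0] to [s]. Then [L
    (Phi s)] has derivative [L (f s)], by differentiation under [L];
    integrating this derivative from [a] to [b] gives [L (Phi b) - L (Phi
    a)]. *)
Lemma io_fubini_interval {X : topologicalType} {K : set X} {L : (X -> R) -> R}
    (HL : integral_on K L) {f : R -> X -> R} {a b : R} : a <= b ->
  continuous (fun z : R * X => f z.1 z.2) ->
  interval_integral a b (fun s => L (f s)) =
  L (fun x => interval_integral a b (f ^~ x)).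
Proof.
move=> ab cf; pose a0 := a - 1.
have a0a : a0 < a by rewrite /a0; lra.
pose Phi s x := interval_integral a0 s (f ^~ x).
have cfx x : continuous (f ^~ x) by exact: continuous_slicel.
have dPhi (s : R) : a0 < s -> forall x, is_derive s (1 : R) (Phi ^~ x) (f s x).
  by move=> a0s x; exact: is_derive_primitive.
have cPhi s : continuous (Phi s).
  exact: (io_continuous (interval_integralP a0 s) (f := fun x t =>
      f t x) (continuous_swapf cf)).
have dL (s : R) : a0 < s -> is_derive s (1 : R) (fun s => L (Phi s)) (L (f s)).
  move=> a0s; apply: (io_derive HL) => //.
    by near=> t.
  near=> t; apply: dPhi.
  by near: t; exact: lt_nbhsr.
rewrite (interval_FTC2 a0a ab (io_continuous HL cf) dL) -(io_sub HL)//.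
by apply: (io_local HL) => x _; rewrite (interval_FTC2 a0a ab (cfx x) (fun s h =>
    dPhi s h x)).
Unshelve. all: by end_near. Qed.

(** On a small interval around [s0] the mean value theorem, applied to a
    primitive, gives a positive contribution; the rest of the interval
    contributes nothing negative. *)
Lemma interval_integral_gt0 (a b s0 : R) (f : R -> R) : continuous f ->
  (forall s, s \in `[a, b] -> 0 <= f s) -> a < s0 < b -> 0 < f s0 ->
  0 < interval_integral a b f.
Proof.
move=> cf f0 /andP[as0 s0b] fs0.
have [e /= e0 He] : \forall s \near s0, [/\ 0 < f s, a < s & s < b].
  by near=> s; split; near: s; [exact: (cvgr_gt (f s0) (cf s0))|exact:
      lt_nbhsr|exact: lt_nbhsl].
have a1a : a - 1 < a by lra.
pose c := s0 - e / 2; pose d := s0 + e / 2.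
have ce s : c <= s <= d -> [/\ 0 < f s, a < s & s < b].
  move=> /andP[cs sd]; apply: He; rewrite /ball /= ltr_norml.
  by move: cs sd; rewrite /c /d => cs sd; apply/andP; split; lra.
have [_ ac _] : [/\ 0 < f c, a < c & c < b] by apply: ce; rewrite /c /d; apply/andP;
    split; lra.
have [_ ad db] : [/\ 0 < f d, a < d & d < b] by apply: ce; rewrite /c /d; apply/andP;
    split; lra.
have cd : c < d by rewrite /c /d; lra.
have FTC x y : a <= x -> x <= y -> interval_integral x y f =
    interval_integral (a - 1) y f - interval_integral (a - 1) x f.
  move=> ax xy; apply: (@interval_FTC2 (a - 1) x y (fun t =>
      interval_integral (a - 1) t f) f) => //; first by lra.
  by move=> z az; exact: is_derive_primitive.
have -> : interval_integral a b f =
    interval_integral a c f + interval_integral c d f + interval_integral d b f.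
  rewrite (FTC a b) ?(FTC a c) ?(FTC c d) ?(FTC d b) ?lexx// ?ltW//; first by ring.
  exact: lt_trans db.
have ge0 x y : a <= x -> y <= b -> 0 <= interval_integral x y f.
  move=> ax yb; apply: (io_ge0 (interval_integralP x y)) => // z /=;
      rewrite in_itv/= => /andP[xz zy].
  by apply: f0; rewrite in_itv/= (le_trans ax xz) (le_trans zy yb).
rewrite ltr_wpDr ?ge0 ?(ltW ad)// ltr_wpDl ?ge0 ?(ltW (lt_trans cd db))//.
rewrite (FTC c d) ?(ltW ac) ?(ltW cd)//.
have dF z : a - 1 < z -> is_derive (z : R) (1 : R)
   (fun t => interval_integral (a - 1) t f : R) (f z).
  by move=> az; exact: is_derive_primitive.
have [||z] := @MVT R (fun t => interval_integral (a - 1) t f) f c d cd.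
- by move=> z; rewrite in_itv/= => /andP[cz zd]; apply: dF; lra.
- apply: derivable_within_continuous => z; rewrite in_itv/= => /andP[cz zd].
  by have [] // := dF z _; lra.
rewrite in_itv/= => /andP[cz zd] ->; rewrite mulr_gt0 ?subr_gt0//.
by have [] := ce z; rewrite ?(ltW cz) ?(ltW zd).
Unshelve. all: by end_near. Qed.
End Interval.

(** * Iterated integrals over boxes *)

Section AffineDerive.
Context {R : realType} {V W : normedModType R}.

(** Restriction of a directional derivative along a map that carries the
    direction [w] to [v]. It relates derivatives on slices of a product, on
    translates and along lines to those of the ambient function. *)
Lemma is_derive_affine {F : V -> R} {phi : W -> V} {v : V} {w u : W} {d : R} :
  (forall h : R, phi (h *: w + u) = h *: v + phi u) ->
  is_derive (phi u) v F d -> is_derive u w (fun z => F (phi z)) d.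
Proof.
move=> hphi [dF <-].
have E : (fun h : R => h^-1 *: ((F \o phi) (h *: w + u) - (F \o phi) u)) =
    (fun h : R => h^-1 *: (F (h *: v + phi u) - F (phi u))).
  by apply/funext => h /=; rewrite hphi.
split; first by move: dF; rewrite /derivable /= -[in X in _ -> X]/(F \o phi) E.
by rewrite /derive /= -[in LHS]/(F \o phi) E.
Qed.
End AffineDerive.

Section Cons.
Context {R : realType} {n : nat}.

Definition consr (s : R) (u : 'rV[R]_n) : 'rV[R]_n.+1 := row_mx s%:M u : 'rV[R]_(1 + n).

Lemma consr0 s u : consr s u 0 ord0 = s.
Proof.
have -> : (ord0 : 'I_n.+1) = @lshift 1 n ord0 by apply: val_inj.
by apply: etrans (row_mxEl _ _ _ _) _; rewrite mxE.
Qed.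

Lemma consrS s u j : consr s u 0 (lift ord0 j) = u 0 j.
Proof.
have -> : lift ord0 j = @rshift 1 n j by apply: val_inj.
exact: row_mxEr.
Qed.

Lemma consr_eta (x : 'rV[R]_n.+1) : x = consr (x 0 ord0) (\row_j x 0 (lift ord0 j)).
Proof.
apply/rowP => i; case: (unliftP ord0 i) => [j ->|->].
  by rewrite consrS mxE.
by rewrite consr0.
Qed.

Lemma consr_shift0 (h s : R) u :
  consr (h *: 1 + s) u = h *: delta_mx 0 ord0 + consr s u.
Proof.
apply/rowP => i; case: (unliftP ord0 i) => [j ->|->].
  by rewrite [RHS]mxE !consrS !mxE/= mulr0 add0r.
by rewrite [RHS]mxE !consr0 !mxE /=.
Qed.

Lemma consr_shiftS (h s : R) j u :
  consr s (h *: delta_mx 0 j + u) = h *: delta_mx 0 (lift ord0 j) + consr s u.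
Proof.
apply/rowP => i; case: (unliftP ord0 i) => [l ->|->].
  by rewrite [RHS]mxE !consrS !mxE (inj_eq lift_inj).
by rewrite [RHS]mxE !consr0 !mxE /= mulr0 add0r.
Qed.
End Cons.

Section RowContinuity.
Context {R : realType}.

Lemma continuous_rowf {Z : topologicalType} {n : nat} {f : Z -> 'rV[R]_n} :
  (forall j, continuous (fun z => f z 0 j)) -> continuous f.
Proof.
move=> cf z A [P fP PA].
have : \forall w \near z, forall j, P 0 j (f w 0 j).
  exact: (@filter_forall _ _ (fun j w => P 0 j (f w 0 j)) (nbhs z) _ (fun j =>
      cf j z (P 0 j) (fP 0 j))).
by apply: filterS => w Pw; apply: PA => i j; rewrite ord1.
Qed.

Lemma continuous_coordf {Z : topologicalType} {m n : nat} {f : Z -> 'M[R]_(m, n)} i j :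
  continuous f -> continuous (fun z => f z i j).
Proof.
move=> cf z; have H := @coord_continuous R m n i j (f z).
exact: (@continuous_comp Z 'M[R]_(m, n) R f (fun M => M i j) z (cf z) H).
Qed.

Lemma continuous_consr {n : nat} :
  continuous (fun z : R * 'rV[R]_n => consr z.1 z.2).
Proof.
apply: continuous_rowf => i; case: (unliftP ord0 i) => [j ->|->].
  under eq_fun do rewrite consrS.
  by apply: continuous_coordf; apply: continuous_sndf; exact: continuous_idf.
under eq_fun do rewrite consr0.
by apply: continuous_fstf; exact: continuous_idf.
Qed.

Lemma continuous_addv {Z : topologicalType} {V : normedModType R} {f g : Z -> V} :
  continuous f -> continuous g -> continuous (fun z => f z + g z).
Proof. by move=> cf cg z; apply: cvgD; [exact: cf|exact: cg]. Qed.

Lemma continuous_subv {Z : topologicalType} {V : normedModType R} {f g : Z -> V} :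
  continuous f -> continuous g -> continuous (fun z => f z - g z).
Proof. by move=> cf cg z; apply: cvgB; [exact: cf|exact: cg]. Qed.
End RowContinuity.

Section Box.
Context {R : realType} (M : R).

Lemma interval_dominated (a b C : R) (g_ : nat -> R -> R) (g : R -> R) :
  (forall k, continuous (g_ k)) -> (forall k s, a <= s <= b -> `|g_ k s| <= C) ->
  (forall s, a <= s <= b -> g_ k s @[k --> \oo] --> g s) ->
  interval_integral a b (g_ k) @[k --> \oo] --> interval_integral a b g.
Proof.
move=> cg gC gg.
pose mu := @lebesgue_measure R.
have mg_ k : measurable_fun `[a, b] (g_ k).
  by have /measurable_int/measurable_EFinP := continuous_integrable a b (cg k).
have mg : measurable_fun `[a, b] g.
  by apply: (measurable_fun_cvg mg_) => s /=; rewrite in_itv/= => /gg.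
have [] := @dominated_convergence _ _ _ mu `[a, b] (measurable_itv `[a, b])
  (fun k => EFin \o g_ k) (EFin \o g) (EFin \o cst C).
- by move=> k; apply/measurable_EFinP; exact: mg_.
- by apply/measurable_EFinP; exact: mg.
- by apply: aeW => s /=; rewrite in_itv/= => /gg h; apply: cvg_EFin => //; exact: nearW.
- by apply: continuous_integrable; exact: continuous_cstf.
- by apply: aeW => s k /=; rewrite in_itv/= => /gC h; rewrite lee_fin.
move=> ig _ h; apply: fine_cvg; move: h; rewrite fineK//.
exact: integrable_fin_num.
Qed.

Definition box (n : nat) : set 'rV[R]_n := [set x | forall i, - M <= x 0 i <= M].

(** The iterated integral over the cube of half-side [M], which unlike
    [integral_Rn] is a functional on all continuous functions. *)
Fixpoint box_integral (n : nat) : ('rV[R]_n -> R) -> R :=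
  match n with
  | 0%N => fun f => f 0
  | n'.+1 => fun f => interval_integral (- M) M (fun s =>
      box_integral n' (fun u => f (consr s u)))
  end.

Lemma box_consr (n : nat) (s : R) (u : 'rV[R]_n) :
  - M <= s <= M -> box n u -> box n.+1 (consr s u).
Proof.
move=> sM uM i; case: (unliftP ord0 i) => [j ->|->].
  by rewrite consrS.
by rewrite consr0.
Qed.

Lemma box_compact n : compact (box n).
Proof.
have := @rV_compact R n (fun=> `[- M, M]%classic) (fun=> @segment_compact R (- M) M).
by congr compact; apply/seteqP; split => x /= h i; move: (h i); rewrite in_itv.
Qed.

Lemma box_integralP n : integral_on (box n) (box_integral n).
Proof.
have HI := interval_integralP (- M) M.
elim: n => [|n IH].
  have b0 : box 0 0 by move=> [].
  split => /=; first exact: box_compact.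
  - by move=> f g; apply.
  - by [].
  - by [].
  - by move=> f _; apply.
have csl (f : 'rV[R]_n.+1 -> R) : continuous f ->
    continuous (fun z : R * 'rV[R]_n => f (consr z.1 z.2)).
  by move=> cf; apply: continuous_compf; [exact: cf|exact: continuous_consr].
have csl' (f : 'rV[R]_n.+1 -> R) s : continuous f -> continuous (fun u =>
    f (consr s u)).
  by move=> /csl cf; exact: (continuous_slicer (f := fun s u => f (consr s u)) s cf).
have cbox (f : 'rV[R]_n.+1 -> R) : continuous f ->
    continuous (fun s => box_integral n (fun u => f (consr s u))).
  by move=> cf; exact: (io_continuous IH (f := fun s u => f (consr s u)) (csl _ cf)).
split; first exact: box_compact.
- move=> f g fg /=; apply: (io_local HI) => s; rewrite /= in_itv/= => sM.
  apply: (io_local IH) => u uM; apply: fg; exact: box_consr.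
- move=> f g cf cg /=; rewrite -(io_add HI); [|exact: cbox..].
  by apply: (io_local HI) => s _; rewrite (io_add IH)//; exact: csl'.
- move=> a f cf /=; rewrite -(io_scale HI); [|exact: cbox].
  by apply: (io_local HI) => s _; rewrite (io_scale IH)//; exact: csl'.
- move=> f cf f0 /=; apply: (io_ge0 HI); first exact: cbox.
  move=> s; rewrite /= in_itv/= => sM; apply: (io_ge0 IH); first exact: csl'.
  by move=> u uM; apply: f0; exact: box_consr.
Qed.

Lemma continuous_consr_slice {n} {f : 'rV[R]_n.+1 -> R} : continuous f ->
  continuous (fun z : R * 'rV[R]_n => f (consr z.1 z.2)).
Proof. by move=> cf; apply: continuous_compf; [exact: cf|exact: continuous_consr]. Qed.

Lemma continuous_consrr {n} {f : 'rV[R]_n.+1 -> R} (s : R) : continuous f ->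
  continuous (fun u : 'rV[R]_n => f (consr s u)).
Proof.
move=> /continuous_consr_slice cf.
exact: (continuous_slicer (f := fun s u => f (consr s u)) s cf).
Qed.

(** The inner integrals are bounded by the dominating constant times the
    volume of the inner cube, so that the one-dimensional case applies
    again. *)
Lemma box_dominated n (C : R) (f_ : nat -> 'rV[R]_n -> R) (f : 'rV[R]_n -> R) :
  (forall k, continuous (f_ k)) -> (forall k x, box n x -> `|f_ k x| <= C) ->
  (forall x, box n x -> f_ k x @[k --> \oo] --> f x) ->
  box_integral n (f_ k) @[k --> \oo] --> box_integral n f.
Proof.
elim: n f_ f => [|n IH] f_ f cf fC ff /=; first by apply: ff => -[].
apply: (@interval_dominated _ _ (C * box_integral n (fun=> 1))).
- move=> k; exact: (io_continuous (box_integralP n) (f := fun s u => f_ k (consr s u))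
    (continuous_consr_slice (cf k))).
- move=> k s sM; apply: (io_bound (box_integralP n)).
    exact: continuous_consrr.
  by move=> u uM; apply: fC; exact: box_consr.
- move=> s sM; apply: IH => [k|k u uM|u uM].
  + exact: continuous_consrr.
  + by apply: fC; exact: box_consr.
  + by apply: ff; exact: box_consr.
Qed.

(** By induction on the dimension, every inner integrand is zero outside the
    cube. *)
Lemma integral_Rn_box n (f : 'rV[R]_n -> R) :
  (forall x, ~ box n x -> f x = 0) -> integral_Rn f = box_integral n f.
Proof.
elim: n f => [//|n IH] f f0 /=.
rewrite /interval_integral [RHS]Rintegral_mkcond; apply: eq_Rintegral => s _.
rewrite patchE; case: ifPn => [|/negP sM].
  rewrite inE/= in_itv/= => sM; apply: IH => u uM; apply: f0 => h; apply: uM => j.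
  by have := h (lift ord0 j); rewrite consrS.
rewrite (IH (fun u => f (consr s u))); last first.
  by move=> u uM; apply: f0 => h; apply: sM; have := h ord0;
      rewrite consr0 inE/= in_itv.
apply: (io_eq0 (box_integralP n)) => u _; apply: f0 => h; apply: sM.
by have := h ord0; rewrite consr0 inE/= in_itv.
Qed.

(** The exchange with one interval at a time; the inner integral is
    continuous in the remaining variables. *)
Lemma io_fubini_box {X : topologicalType} {K : set X} {L : (X -> R) -> R}
    (HL : integral_on K L) {n : nat} {f : 'rV[R]_n -> X -> R} : 0 <= M ->
  continuous (fun z : 'rV[R]_n * X => f z.1 z.2) ->
  box_integral n (fun u => L (f u)) = L (fun x => box_integral n (f ^~ x)).
Proof.
move=> M0; elim: n f => [//|n IH] f cf /=.
have cs s : continuous (fun z : 'rV[R]_n * X => f (consr s z.1) z.2).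
  apply: (@continuous_app2 _ _ _ _ f (fun z : 'rV[R]_n * X => consr s z.1) snd cf).
    apply: (@continuous_app2 _ _ _ _ (@consr R n) (fun=> s) fst continuous_consr).
      exact: continuous_cstf.
    by apply: continuous_fstf; exact: continuous_idf.
  by apply: continuous_sndf; exact: continuous_idf.
transitivity (interval_integral (- M) M (fun s =>
    L (fun x => box_integral n (fun u => f (consr s u) x)))).
  by apply: (io_local (interval_integralP _ _)) => s _;
      rewrite (IH (fun u => f (consr s u))).
rewrite (io_fubini_interval HL)//; first by lra.
have cc : continuous (fun z : (R * X) * 'rV[R]_n => f (consr z.1.1 z.2) z.1.2).
  apply: (@continuous_app2 _ _ _ _ f (fun z : (R * X) * 'rV[R]_n =>
      consr z.1.1 z.2) (fun z => z.1.2) cf).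
    apply: (@continuous_app2 _ _ _ _ (@consr R n) (fun z =>
        z.1.1) snd continuous_consr).
      by do 2 apply: continuous_fstf; exact: continuous_idf.
    by apply: continuous_sndf; exact: continuous_idf.
  by apply: continuous_sndf; apply: continuous_fstf; exact: continuous_idf.
exact: (io_continuous (box_integralP n)
  (f := fun (z : R * X) u => f (consr z.1 u) z.2) cc).
Qed.

(** The inner integral is a continuous nonnegative function of the first
    coordinate, positive at that of [x0]. *)
Lemma box_integral_gt0 n (f : 'rV[R]_n -> R) (x0 : 'rV[R]_n) : continuous f ->
  (forall x, box n x -> 0 <= f x) -> (forall i, - M < x0 0 i < M) -> 0 < f x0 ->
  0 < box_integral n f.
Proof.
elim: n f x0 => [|n IH] f x0 cf f0 x0M fx0 /=.
  by move: fx0; congr (0 < f _); apply/rowP => -[].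
apply: (@interval_integral_gt0 _ _ _ (x0 0 ord0)) => //.
- exact: (io_continuous (box_integralP n) (f := fun s u => f (consr s u))
    (continuous_consr_slice cf)).
- move=> s; rewrite in_itv/= => sM; apply: (io_ge0 (box_integralP n)).
    exact: continuous_consrr.
  by move=> u uM; apply: f0; exact: box_consr.
- apply: (IH _ (\row_j x0 0 (lift ord0 j))).
  + exact: continuous_consrr.
  + move=> u uM; apply: f0; apply: box_consr => //.
    by have /andP[/ltW -> /ltW ->] := x0M ord0.
  + by move=> i; rewrite mxE.
  + by rewrite -consr_eta.
Qed.

(** In the first coordinate, differentiation passes under the inner integral
    and the fundamental theorem applies, with vanishing boundary values. In
    the other coordinates the inner integral already vanishes. *)
Lemma box_integral_derive n (i : 'I_n) (F : 'rV[R]_n -> R) : 0 <= M ->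
  continuous F -> (forall x, derivable F x (delta_mx 0 i)) ->
  continuous (fun x => 'D_(delta_mx 0 i) F x) ->
  (forall x : 'rV[R]_n, `|x 0 i| = M -> F x = 0) ->
  box_integral n (fun x => 'D_(delta_mx 0 i) F x) = 0.
Proof.
move=> M0; elim: n i F => [[]//|n IH] i F cF dF cF' F0 /=.
have HB := box_integralP n.
have dFx x : is_derive x (delta_mx 0 i) F ('D_(delta_mx 0 i) F x) by apply/derivableP.
case: (unliftP ord0 i) => [j ij|i0]; last first.
  pose G s := box_integral n (fun u => F (consr s u)).
  pose g s := box_integral n (fun u => 'D_(delta_mx 0 i) F (consr s u)).
  have cg : continuous g.
    exact: (io_continuous HB (f := fun s u => 'D_(delta_mx 0 i) F (consr s u))
      (continuous_consr_slice cF')).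
  have dG (s : R) : - M - 1 < s -> is_derive s (1 : R) G (g s).
    move=> _; apply: (io_derive HB (g := fun s u => F (consr s u))
      (g' := fun s u => 'D_(delta_mx 0 i) F (consr s u))).
    + by near=> t; exact: continuous_consrr.
    + exact: (continuous_consr_slice cF').
    + near=> t => u; apply: (@is_derive_affine _ _ _ F (consr^~ u)) => //.
      by move=> h; rewrite consr_shift0 i0.
  have M1 : - M - 1 < - M by lra.
  have MM : - M <= M by lra.
  rewrite (interval_FTC2 M1 MM cg dG) /G.
  rewrite !(io_eq0 HB) ?subrr// => u _; apply: F0;
      rewrite i0 consr0 ?normrN ger0_norm//.
apply: (io_eq0 (interval_integralP _ _)) => s _.
have dFs u : is_derive u (delta_mx 0 j) (fun u => F (consr s u))
    ('D_(delta_mx 0 i) F (consr s u)).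
  by apply: (@is_derive_affine _ _ _ F (consr s)) => // h; rewrite consr_shiftS ij.
have E : (fun u => 'D_(delta_mx 0 i) F (consr s u)) =
    (fun u => 'D_(delta_mx 0 j) (fun u => F (consr s u)) u).
  by apply/funext => u; have [_ ->] := dFs u.
rewrite E; apply: IH.
- exact: continuous_consrr.
- by move=> u; have [] := dFs u.
- by rewrite -E; exact: (continuous_consrr (f := fun x => 'D_(delta_mx 0 i) F x)).
- by move=> u uM; apply: F0; rewrite ij consrS.
Unshelve. all: by end_near. Qed.
End Box.

(** * Integrals over compact sets *)

Lemma continuous_maxf {R : realType} {X : topologicalType} {f g : X -> R} :
  continuous f -> continuous g -> continuous (fun x => Num.max (f x) (g x)).
Proof. by move=> cf cg x; apply: continuous_max; [exact: cf|exact: cg]. Qed.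

Section Pushforward.
Context {R : realType} {X Y : topologicalType}.

Lemma pushforward_integralP {K : set X} {S : set Y} {L : (X -> R) -> R} {phi : X -> Y} :
  integral_on K L -> continuous phi -> compact S -> (forall x, K x -> S (phi x)) ->
  integral_on S (fun f => L (fun x => f (phi x))).
Proof.
move=> HL cphi cS KS; split => //.
- by move=> f g fg; apply: (io_local HL) => x /KS/fg.
- by move=> f g cf cg; rewrite -(io_add HL)//; exact: continuous_compf.
- by move=> a f cf; rewrite -(io_scale HL)//; exact: continuous_compf.
- by move=> f cf f0; apply: (io_ge0 HL) => [|x /KS/f0//]; exact: continuous_compf.
Qed.
End Pushforward.

Section Distance.
Context {R : realType} {V : normedModType R} (K : set V).

Definition dist_to (x : V) : R := inf [set `|x - a| | a in K].

Hypothesis K0 : K !=set0.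

Let dist_to_lb (x : V) : has_lbound [set `|x - a| | a in K].
Proof. by exists 0 => _ [a _ <-]. Qed.

Lemma dist_to_ge0 x : 0 <= dist_to x.
Proof.
apply: lb_le_inf; last by move=> _ [a _ <-].
by have [a Ka] := K0; exists `|x - a|; exists a.
Qed.

Lemma dist_to_eq0 x : K x -> dist_to x = 0.
Proof.
move=> Kx; apply/eqP; rewrite eq_le dist_to_ge0 andbT.
by apply: ge_inf => //; exists x => //; rewrite subrr normr0.
Qed.

Lemma dist_to_lip x y : dist_to x - dist_to y <= `|x - y|.
Proof.
rewrite lerBlDl -lerBlDr; apply: lb_le_inf.
  by have [a Ka] := K0; exists `|y - a|; exists a.
move=> _ [a Ka <-]; rewrite lerBlDr; apply: (@le_trans _ _ `|x - a|).
  by apply: ge_inf => //; exists a.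
rewrite (_ : x - a = (y - a) + (x - y)); first exact: ler_normD.
by rewrite [RHS]addrC subrKA.
Qed.

Lemma dist_to_continuous : continuous dist_to.
Proof.
move=> x; apply/cvgrPdist_le => e e0; near=> y.
apply: (@le_trans _ _ `|x - y|); last first.
  by near: y; move/cvgrPdist_le : (@continuous_idf V x); apply.
rewrite ler_norml dist_to_lip andbT lerNl opprB.
by rewrite (le_trans (dist_to_lip _ _))// distrC.
Unshelve. all: by end_near. Qed.

Lemma dist_to_gt0 x : closed K -> ~ K x -> 0 < dist_to x.
Proof.
move=> /closed_openC oK nKx.
have /nbhs_ballP[e /= e0 he] := open_nbhs_nbhs (conj oK nKx).
apply: (@lt_le_trans _ _ e) => //; apply: lb_le_inf.
  by have [a Ka] := K0; exists `|x - a|; exists a.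
move=> _ [a Ka <-]; rewrite leNgt; apply/negP => xa.
by apply: (he a) Ka; rewrite -ball_normE.
Qed.

(** Continuous functions that decrease to the indicator of [K] when [K] is
    closed and nonempty. *)
Definition cutoff (k : nat) (x : V) : R := Num.max 0 (1 - k%:R * dist_to x).

Lemma cutoff_continuous k : continuous (cutoff k).
Proof.
have c : continuous (fun x => 1 - k%:R * dist_to x).
  apply: continuous_subf; first exact: continuous_cstf.
  by apply: continuous_mulf; [exact: continuous_cstf|exact: dist_to_continuous].
exact: (continuous_maxf (continuous_cstf 0) c).
Qed.

Lemma cutoff_ge0 k x : 0 <= cutoff k x.
Proof. by rewrite /cutoff le_max lexx. Qed.

Lemma cutoff_le1 k x : cutoff k x <= 1.
Proof. by rewrite /cutoff ge_max ler01 gerBl mulr_ge0// dist_to_ge0. Qed.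

Lemma cutoff_cvg x : closed K -> cutoff k x @[k --> \oo] --> (\1_K x : R).
Proof.
move=> cK; rewrite indicE; case: (boolP (x \in K)) => [|/negP xK] /=.
  rewrite inE => Kx; under eq_fun do rewrite /cutoff dist_to_eq0// mulr0 subr0 max_r//.
  exact: cvg_cst.
have d0 : 0 < dist_to x by apply: dist_to_gt0 => // Kx; apply: xK; rewrite inE.
apply: (@cvg_near_cst _ R); near=> k.
rewrite /cutoff max_l// subr_le0 -ler_pdivrMr//.
by near: k; exact: nbhs_infty_ger.
Unshelve. all: by end_near. Qed.
End Distance.

Section CompactIndicator.
Context {R : realType} {n : nat}.

Lemma compact_sub_box {K : set 'rV[R]_n} : compact K ->
    exists2 M, 0 <= M & K `<=` box M n.
Proof.
move=> /compact_bounded [M [Mr HM]]; exists (Num.max 0 (M + 1)).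
  by rewrite le_max lexx.
move=> x Kx i; rewrite -ler_norml le_max; apply/orP; right.
apply: le_trans (HM (M + 1) _ x Kx); last by rewrite ltrDl.
rewrite [leRHS]/Num.norm/= mx_normrE.
by apply: (le_bigmax _ (fun ij : 'I_1 * 'I_n => `|x ij.1 ij.2|) (0, i)).
Qed.

(** The indicator of [K] is a bounded pointwise limit of the continuous
    cutoffs, so that linearity and positivity pass from the cube to [K] in
    the limit. *)
Lemma compact_integralP {K : set 'rV[R]_n} : compact K ->
  integral_on K (fun f => integral_Rn (fun u => f u * \1_K u)).
Proof.
move=> cK; have [M M0 KM] := compact_sub_box cK.
have [->|/set0P K0] := eqVneq K set0.
  have E (f : 'rV[R]_n -> R) : integral_Rn (fun u => f u * \1_set0 u) = 0.
    rewrite (@integral_Rn_box R M).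
      by apply: (io_eq0 (box_integralP M n)) => u _; rewrite indic0 mulr0.
    by move=> u _; rewrite indic0 mulr0.
  by split => // *; rewrite ?E ?addr0 ?mulr0//; exact: compact0.
have clK : closed K by apply: compact_closed => //; exact: norm_hausdorff.
have HB := box_integralP M n.
have ccut (f : 'rV[R]_n -> R) k : continuous f -> continuous (fun u =>
    f u * cutoff K k u).
  by move=> cf; apply: continuous_mulf => //; exact: cutoff_continuous.
have LE (f : 'rV[R]_n -> R) : integral_Rn (fun u =>
    f u * \1_K u) = box_integral M n (fun u => f u * \1_K u).
  apply: integral_Rn_box => u Mu; rewrite indicE.
  by case: (boolP (u \in K)) => [|_]; [rewrite inE => /KM|rewrite mulr0].
have Lcvg (f : 'rV[R]_n -> R) : continuous f -> box_integral M n (fun u =>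
    f u * cutoff K k u) @[k --> \oo] -->
    integral_Rn (fun u => f u * \1_K u).
  move=> cf; rewrite LE.
  have [C HC] : exists C, forall u, box M n u -> `|f u| <= C.
    have /compact_bounded[C [Cr HC]] : compact (f @` box M n).
      apply: continuous_compact; last exact: box_compact.
      exact: continuous_subspaceT.
    exists (C + 1) => u Mu; apply: (HC (C + 1)); first by rewrite ltrDl.
    by exists u.
  apply: (@box_dominated R M n C) => [k|k u Mu|u Mu].
  - exact: ccut.
  - rewrite normrM (ger0_norm (cutoff_ge0 _ _ _)).
    by rewrite (le_trans _ (HC u Mu))// ler_piMr// cutoff_le1.
  - by apply: cvgM; [exact: cvg_cst|exact: cutoff_cvg].
split => //.
- move=> f g fg; congr integral_Rn; apply/funext => u; rewrite indicE.
  by case: (boolP (u \in K)) => [|_]; [rewrite inE => /fg ->|rewrite !mulr0].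
- move=> f g cf cg.
  apply: (@cvg_unique _ (@Rhausdorff R) _ _ _ _ (Lcvg _ (continuous_addf cf cg))).
  rewrite (_ : (fun k => _) = (fun k => box_integral M n (fun u => f u * cutoff K k u) +
    box_integral M n (fun u => g u * cutoff K k u))).
    by apply: cvgD; exact: Lcvg.
  apply/funext => k; rewrite -(io_add HB); [|exact: ccut..].
  by apply: (io_local HB) => u _; rewrite mulrDl.
- move=> a f cf.
  apply: (@cvg_unique _ (@Rhausdorff R) _ _ _ _
    (Lcvg _ (continuous_mulf (continuous_cstf a) cf))).
  rewrite (_ : (fun k => _) = (fun k => a * box_integral M n (fun u =>
      f u * cutoff K k u))).
    by apply: cvgM; [exact: cvg_cst|exact: Lcvg].
  apply/funext => k; rewrite -(io_scale HB); last exact: ccut.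
  by apply: (io_local HB) => u _; rewrite mulrA.
- move=> f cf f0.
  (* f is nonnegative on K only, but the indicator does not distinguish it from
     its positive part. *)
  have cm : continuous (fun u => Num.max 0 (f u)).
    exact: (continuous_maxf (continuous_cstf 0) cf).
  rewrite (_ : (fun u => f u * _) = (fun u => Num.max 0 (f u) * \1_K u)).
    apply: (cvgr_to_ge (Lcvg _ cm)).
    apply: nearW => k; apply: (io_ge0 HB); first exact: ccut.
    by move=> u _; rewrite mulr_ge0 ?cutoff_ge0// le_max lexx.
  apply/funext => u; rewrite indicE.
  case: (boolP (u \in K)) => [|_]; last by rewrite !mulr0.
  by rewrite inE => /f0 fu; rewrite max_r.
Qed.
End CompactIndicator.

(** * The receiver surface, and integration by parts in space *)

Section ContinuityVectors.
Context {R : realType}.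

Lemma continuous_mulmxr {Z : topologicalType} {m n : nat} {f : Z ->
    'rV[R]_m} (A : 'M[R]_(m, n)) :
  continuous f -> continuous (fun z => f z *m A).
Proof.
move=> cf; apply: continuous_rowf => j.
rewrite (_ : (fun z => _) = (fun z => \sum_k f z 0 k * A k j)); last first.
  by apply/funext => z; rewrite mxE.
apply: continuous_sumf => k; apply: continuous_mulf; last exact: continuous_cstf.
exact: continuous_coordf.
Qed.

Lemma continuous_dotl {Z : topologicalType} {n : nat} {f : Z ->
    'rV[R]_n} (a : 'rV[R]_n) :
  continuous f -> continuous (fun z => dot (f z) a).
Proof.
move=> cf; rewrite /dot; apply: continuous_sumf => k.
by apply: continuous_mulf; [exact: continuous_coordf|exact: continuous_cstf].
Qed.
End ContinuityVectors.

Section Surface.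
Context {R : realType} {d : nat} (b : R) (Omega : set 'rV[R]_d) (r : receiver R d).
Hypothesis Hr : is_receiver b Omega r.

Lemma rc_surface_closed : closed (rc_surface Omega r).
Proof.
apply: closedI.
  have cd : continuous (fun x : 'rV[R]_d => dot (x - rc_point r) (rc_normal r)).
    apply: continuous_dotl.
    by apply: continuous_subv; [exact: continuous_idf|exact: continuous_cstf].
  exact: (iffLR (continuous_closedP _) cd [set y | y = 0] (@closed_eq R 0)).
rewrite /bdry setDE; apply: closedI; first exact: closed_closure.
by apply: open_closedC; exact: open_interior.
Qed.

Lemma rc_surface_compact : compact (rc_surface Omega r).
Proof.
by have [_ _ _ bS _] := Hr; apply: bounded_closed_compact => //;
    exact: rc_surface_closed.
Qed.

(** In the orthonormal coordinates of the frame the surface is a compact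
    set: the transposed frame inverts the parametrization, so the
    coordinates range over the continuous image of a bounded closed set. *)
Lemma surface_integralP : integral_on (rc_surface Omega r) (surface_integral Omega r).
Proof.
have [_ [frame1 _] _ _ _] := Hr.
pose S := rc_surface Omega r.
pose par (u : 'rV[R]_(d.-1)) := rc_point r + u *m rc_frame r.
pose unpar (x : 'rV[R]_d) := (x - rc_point r) *m (rc_frame r)^T.
have cpar : continuous par.
  apply: continuous_addv; first exact: continuous_cstf.
  by apply: continuous_mulmxr; exact: continuous_idf.
have cunpar : continuous unpar.
  apply: continuous_mulmxr; apply: continuous_subv; first exact: continuous_idf.
  exact: continuous_cstf.
have parK u : unpar (par u) = u.
  by rewrite /unpar /par addrC addKr -mulmxA frame1 mulmx1.
pose K := [set u | S (par u)].
have cK : compact K.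
  apply: (@subclosed_compact _ K (unpar @` S)).
  - exact: (iffLR (continuous_closedP _) cpar S rc_surface_closed).
  - apply: continuous_compact; last exact: rc_surface_compact.
    exact: continuous_subspaceT.
  - by move=> u Ku; exists (par u).
have := pushforward_integralP (compact_integralP cK) cpar rc_surface_compact.
by apply.
Qed.
End Surface.

Section C1.
Context {R : realType} {V : normedModType R}.

(** Continuous differentiability in one direction, all that integration by
    parts in that direction uses. *)
Definition C1_along (v : V) (f : V -> R) : Prop :=
  [/\ continuous f, (forall x, derivable f x v) & continuous (fun x => 'D_v f x)].

Lemma C1_along_derive {v : V} {f : V -> R} {df : V -> R} : continuous f ->
    continuous df ->
  (forall x, is_derive x v f (df x)) -> C1_along v f.
Proof.
move=> cf cdf dfx; split; [exact: cf|by move=> x; have [] := dfx x|].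
by rewrite (_ : (fun x => _) = df)//; apply/funext => x; have [_ ->] := dfx x.
Qed.

Lemma C1_is_derive {v : V} {f : V -> R} : C1_along v f ->
  forall x, is_derive x v f ('D_v f x).
Proof. by move=> [_ df _] x; apply/derivableP. Qed.

Lemma is_derive_mulf {v x : V} {f g : V -> R} {a b : R} :
  is_derive x v f a -> is_derive x v g b ->
  is_derive x v (fun x => f x * g x) (a * g x + f x * b).
Proof.
move=> df dg; have := is_deriveM df dg.
rewrite (_ : f x *: b + g x *: a = a * g x + f x * b)//.
by rewrite /GRing.scale /=; ring.
Qed.

Lemma is_derive_invf {v x : V} {f : V -> R} {a : R} : f x != 0 ->
  is_derive x v f a -> is_derive x v (fun x => (f x)^-1) (- (f x) ^- 2 * a).
Proof.
move=> f0 [df <-]; split; first exact: derivableV.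
exact: deriveV.
Qed.

Lemma C1_mulf {v : V} {f g : V -> R} : C1_along v f -> C1_along v g ->
  C1_along v (fun x => f x * g x).
Proof.
move=> Hf Hg; have [cf _ cf'] := Hf; have [cg _ cg'] := Hg.
apply: (C1_along_derive (df := fun x => 'D_v f x * g x + f x * 'D_v g x)).
- exact: continuous_mulf.
- exact: (continuous_addf (continuous_mulf cf' cg) (continuous_mulf cf cg')).
- by move=> x; exact: (is_derive_mulf (C1_is_derive Hf x) (C1_is_derive Hg x)).
Qed.

Lemma C1_invf {v : V} {f : V -> R} : (forall x, f x != 0) -> C1_along v f ->
  C1_along v (fun x => (f x)^-1).
Proof.
move=> f0 Hf; have [cf _ cf'] := Hf.
apply: (C1_along_derive (df := fun x => - (f x) ^- 2 * 'D_v f x)).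
- exact: continuous_invf.
- apply: continuous_mulf => //; apply: continuous_oppf; apply: continuous_invf.
    by move=> x; rewrite expf_neq0.
  by under eq_fun do rewrite expr2; exact: continuous_mulf.
- by move=> x; apply: is_derive_invf => //; exact: C1_is_derive.
Qed.

Lemma Ck_C1 {k : nat} {f : V -> R} (v : V) : Ck k.+1 f -> C1_along v f.
Proof.
move=> H; have [c d] := H [::] isT; have [c' _] := H [:: v] isT.
by split; [exact: c|move=> x; exact: d|exact: c'].
Qed.

(** The derivative is taken first, so it is appended at the end of the
    sequence of directions. *)
Lemma Ck_derive {k : nat} {f : V -> R} (v : V) : Ck k.+1 f -> Ck k (fun x => 'D_v f x).
Proof.
move=> H vs vsk; have := H (rcons vs v); rewrite size_rcons ltnS => /(_ vsk).
by rewrite /iter_derive foldr_rcons.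
Qed.

End C1.

Section Vanish.
Context {R : realType} {n : nat}.
Implicit Types (u v rho : 'rV[R]_n -> R) (M : R).
Local Notation e i := (delta_mx 0 i : 'rV[R]_n).

(** Support in the cube of half-side [M]. *)
Definition vanish_off M u := forall x, ~ box M n x -> u x = 0.

Lemma vanish_off_derive {M : R} {u : 'rV[R]_n -> R} (w : 'rV[R]_n) : vanish_off M u ->
  vanish_off M (fun x => 'D_w u x).
Proof.
move=> u0 x nx.
have near0 : \forall y \near x, u y = cst 0 y.
  have oC : open (~` box M n).
    by apply: closed_openC; apply: compact_closed;
        [exact: norm_hausdorff|exact: box_compact].
  have := open_nbhs_nbhs (conj oC (nx : (~` box M n) x)).
  by apply: filterS => y ny; exact: u0.
by rewrite (near_eq_derive w near0) derive_cst.
Qed.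

Lemma not_box_boundary {M0 M : R} (i : 'I_n) (x : 'rV[R]_n) :
  M0 < M -> `|x 0 i| = M -> ~ box M0 n x.
Proof. by move=> MM xM /(_ i); rewrite -ler_norml xM leNgt MM. Qed.

(** The product vanishes off a strictly smaller cube, so on the faces of the
    larger one; its derivative then integrates to zero. *)
Lemma box_by_parts {M0 M : R} {i : 'I_n} {u v : 'rV[R]_n -> R} : 0 <= M -> M0 < M ->
  C1_along (e i) u -> C1_along (e i) v -> vanish_off M0 (fun x => u x * v x) ->
  box_integral M n (fun x => 'D_(e i) u x * v x) =
  - box_integral M n (fun x => u x * 'D_(e i) v x).
Proof.
move=> Mge0 MM Hu Hv uv0; have HB := box_integralP M n.
have [cu _ cu'] := Hu; have [cv _ cv'] := Hv.
have Huv := C1_mulf Hu Hv; have [cuv duv cuv'] := Huv.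
have := box_integral_derive M n i _ Mge0 cuv duv cuv'
  (fun x xM => uv0 x (not_box_boundary i x MM xM)).
have E : (fun x => 'D_(e i) (fun x => u x * v x) x) =
   (fun x => 'D_(e i) u x * v x + u x * 'D_(e i) v x).
  apply/funext => x.
  by have [_ ->] := is_derive_mulf (C1_is_derive Hu x) (C1_is_derive Hv x).
rewrite E (io_add HB (continuous_mulf cu' cv) (continuous_mulf cu cv')).
by move/eqP; rewrite addr_eq0 => /eqP.
Qed.

(** The derivatives that occur in a divergence of a gradient: the mixed ones
    are not among them. *)
Definition C2_along_basis u := forall i, C1_along (e i) u /\
  C1_along (e i) (fun x => 'D_(e i) u x).

Lemma C2_along_mul {u v : 'rV[R]_n -> R} : C2_along_basis u -> C2_along_basis v ->
  C2_along_basis (fun x => u x * v x).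
Proof.
move=> Hu Hv i; have [Hu1 Hu2] := Hu i; have [Hv1 Hv2] := Hv i.
have [cu _ cu'] := Hu1; have [cv _ cv'] := Hv1.
have [_ _ cu''] := Hu2; have [_ _ cv''] := Hv2.
split; first exact: C1_mulf.
have -> : (fun x => 'D_(e i) (fun x => u x * v x) x) =
   (fun x => 'D_(e i) u x * v x + u x * 'D_(e i) v x).
  apply/funext => x.
  by have [_ ->] := is_derive_mulf (C1_is_derive Hu1 x) (C1_is_derive Hv1 x).
apply: (C1_along_derive (df := fun x =>
  ('D_(e i) (fun x => 'D_(e i) u x) x * v x + 'D_(e i) u x * 'D_(e i) v x) +
  ('D_(e i) u x * 'D_(e i) v x + u x * 'D_(e i) (fun x => 'D_(e i) v x) x))).
- exact: (continuous_addf (continuous_mulf cu' cv) (continuous_mulf cu cv')).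
- exact: (continuous_addf
    (continuous_addf (continuous_mulf cu'' cv) (continuous_mulf cu' cv'))
    (continuous_addf (continuous_mulf cu' cv') (continuous_mulf cu cv''))).
- move=> x; exact: (is_deriveD
    (is_derive_mulf (C1_is_derive Hu2 x) (C1_is_derive Hv1 x))
    (is_derive_mulf (C1_is_derive Hu1 x) (C1_is_derive Hv2 x))).
Qed.

Section DivGrad.
Context {rho : 'rV[R]_n -> R}.
Hypotheses (rho0 : forall x, rho x != 0) (Hrho : C2_along_basis rho).

Lemma C1_flux {u : 'rV[R]_n -> R} : C2_along_basis u ->
  forall i, C1_along (e i) (fun x => (rho x)^-1 * 'D_(e i) u x).
Proof.
move=> Hu i; apply: C1_mulf; last by have [] := Hu i.
by apply: C1_invf => //; have [] := Hrho i.
Qed.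

Lemma div_grad_invE u x : div_grad_inv rho u x =
  \sum_i 'D_(e i) (fun z => (rho z)^-1 * 'D_(e i) u z) x.
Proof.
rewrite /div_grad_inv /divg; apply: eq_bigr => i _.
have -> : (fun z => ((rho z)^-1 *: grad u z) 0 i) = (fun z =>
    (rho z)^-1 * 'D_(e i) u z).
  by apply/funext => z; rewrite !mxE.
by [].
Qed.

Lemma div_grad_inv_continuous {u : 'rV[R]_n -> R} : C2_along_basis u ->
  continuous (div_grad_inv rho u).
Proof.
move=> Hu; rewrite (_ : div_grad_inv rho u = fun x =>
  \sum_i 'D_(e i) (fun z => (rho z)^-1 * 'D_(e i) u z) x).
  by apply: continuous_sumf => i; have [] := C1_flux Hu i.
by apply/funext => x; rewrite div_grad_invE.
Qed.

(** Integration by parts in each coordinate of the flux (1 / rho) nabla u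
    against [v]. *)
Lemma box_div_grad_inv {M0 M : R} {u v : 'rV[R]_n -> R} : 0 <= M -> M0 < M ->
  C2_along_basis u -> C2_along_basis v ->
  vanish_off M0 u \/ vanish_off M0 v ->
  box_integral M n (fun x => div_grad_inv rho u x * v x) =
  - box_integral M n (fun x => \sum_i (rho x)^-1 * 'D_(e i) u x * 'D_(e i) v x).
Proof.
move=> Mge0 MM Hu Hv uv0; have HB := box_integralP M n.
have cu i : continuous (fun x => (rho x)^-1 * 'D_(e i) u x).
  by have [] := C1_flux Hu i.
have cdu i : continuous (fun x => 'D_(e i) (fun z => (rho z)^-1 * 'D_(e i) u z) x).
  by have [] := C1_flux Hu i.
have cv i : continuous (fun x => 'D_(e i) v x) by have [[]] := Hv i.
have cv0 : 'I_n -> continuous v by move=> i; have [[]] := Hv i.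
rewrite (io_sum HB); last by move=> i; apply: continuous_mulf.
rewrite (io_local HB (g := fun x => \sum_i
   'D_(e i) (fun z => (rho z)^-1 * 'D_(e i) u z) x * v x)); last first.
  by move=> x _; rewrite div_grad_invE mulr_suml.
rewrite (io_sum HB); last by move=> i; apply: continuous_mulf => //; exact: cv0.
rewrite -sumrN; apply: eq_bigr => i _.
apply: (box_by_parts Mge0 MM (C1_flux Hu i)); first by have [] := Hv i.
by case: uv0 => uv0 x nx; [rewrite (vanish_off_derive (e i) uv0 x nx) mulr0 mul0r|
  rewrite uv0// mulr0].
Qed.

(** Both sides equal the integral of - (1 / rho) nabla u . nabla v. *)
Lemma box_div_grad_inv_sym {M0 M : R} {u v : 'rV[R]_n -> R} : 0 <= M -> M0 < M ->
  C2_along_basis u -> C2_along_basis v ->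
  vanish_off M0 u \/ vanish_off M0 v ->
  box_integral M n (fun x => div_grad_inv rho u x * v x) =
  box_integral M n (fun x => u x * div_grad_inv rho v x).
Proof.
move=> Mge0 MM Hu Hv uv0; have HB := box_integralP M n.
rewrite (box_div_grad_inv Mge0 MM Hu Hv uv0).
rewrite (io_local HB (f := fun x => u x * div_grad_inv rho v x)
  (g := fun x => div_grad_inv rho v x * u x)); last by move=> x _; rewrite mulrC.
rewrite (box_div_grad_inv Mge0 MM Hv Hu); last by case: uv0; [right|left].
congr (- _); apply: (io_local HB) => x _; apply: eq_bigr => i _.
by rewrite -!mulrA [X in _ * X]mulrC.
Qed.
End DivGrad.

End Vanish.

(** * Smooth functions: the regularized delta and bumps *)

Section DerivativeClosed.
Context {R : realType}.

(** Smoothness on the line, witnessed by a class of functions that contains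
    [g] and is stable under differentiation; this avoids naming the n-th
    derivative. *)
Definition smooth1 (g : R -> R) : Prop := exists2 B : set (R -> R), B g &
  forall f, B f -> exists2 f', B f' & forall s : R, is_derive s (1 : R) f (f' s).

Lemma smooth1_continuous {g : R -> R} : smooth1 g -> continuous g.
Proof.
move=> [B Bg /(_ _ Bg)[g' _ dg]] s.
by apply: differentiable_continuous; apply/derivable1_diffP; have [] := dg s.
Qed.

Lemma smooth1_derive {g : R -> R} : smooth1 g ->
  exists2 g', smooth1 g' & forall s : R, is_derive s (1 : R) g (g' s).
Proof.
by move=> [B Bg HB]; have [g' Bg' dg] := HB _ Bg; exists g' => //; exists B.
Qed.

Lemma is_derive_near_eq {V : normedModType R} {f g : V -> R} {x v : V} {a : R} :
  (\forall y \near x, f y = g y) -> is_derive x v f a -> is_derive x v g a.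
Proof.
move=> fg [df <-]; split; first exact: near_eq_derivable df.
by apply/esym; exact: near_eq_derive.
Qed.

Lemma is_derive1_direction {g : R -> R} {s a b : R} :
  is_derive s (1 : R) g a -> is_derive s b g (a * b).
Proof.
move=> [/derivable1_diffP dg <-]; split; first exact: diff_derivable.
rewrite !deriveE// -[b in LHS]mulr1 -[b * 1]/(b *: 1) linearZ /=.
by rewrite /GRing.scale /= mulrC.
Qed.

(** Iterated directional derivatives stay in a class that is stable under
    derivation. *)
Lemma smooth_of_class {V : normedModType R} (A : set (V -> R)) :
  (forall f, A f -> continuous f) ->
  (forall f v, A f -> exists2 f', A f' & forall x, is_derive x v f (f' x)) ->
  forall f, A f -> smooth f.
Proof.
move=> Ac Ad f Af k vs _.
have Avs : A (iter_derive f vs).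
  elim: vs => [//|v vs IH] /=.
  have [f' Af' df] := Ad _ v IH.
  rewrite (_ : (fun x => _) = f')//; apply/funext => x.
  by have [_ ->] := df x.
split; first exact: Ac.
by move=> _ x v; have [f' _ df] := Ad _ v Avs; have [] := df x.
Qed.

(** The algebra generated by ridge functions, smooth functions of one affine
    coordinate [l] with linear part [dl]. It is stable under directional
    derivation, by the chain and product rules, and contains all the
    products of one-dimensional profiles needed below. *)
Inductive ridge_algebra {V : normedModType R} : (V -> R) -> Prop :=
| Ridge (g : R -> R) (l dl : V -> R) of smooth1 g & continuous l &
    (forall (h : R) v x, l (h *: v + x) = h * dl v + l x) :
    ridge_algebra (fun x => g (l x))
| RidgeCst (a : R) : ridge_algebra (fun=> a)
| RidgeAdd f g of ridge_algebra f & ridge_algebra g :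
    ridge_algebra (fun x => f x + g x)
| RidgeMul f g of ridge_algebra f & ridge_algebra g :
    ridge_algebra (fun x => f x * g x).

Lemma ridge_continuous {V : normedModType R} (f : V -> R) :
  ridge_algebra f -> continuous f.
Proof.
elim=> [g l dl /smooth1_continuous cg cl _|a|{}f g _ cf _ cg|{}f g _ cf _ cg].
- exact: continuous_compf.
- exact: continuous_cstf.
- exact: continuous_addf.
- exact: continuous_mulf.
Qed.

Lemma ridge_derive {V : normedModType R} (f : V -> R) (v : V) : ridge_algebra f ->
  exists2 f', ridge_algebra f' & forall x, is_derive x v f (f' x).
Proof.
elim=> [g l dl sg cl ll|a|{}f g Af [f' Af' df] Ag [g' Ag' dg]|{}f g Af [f' Af' df] Ag
    [g' Ag' dg]].
- have [g' sg' dg] := smooth1_derive sg.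
  exists (fun x => g' (l x) * dl v).
    by apply: RidgeMul; [exact: (Ridge _ _ dl)|exact: RidgeCst].
  move=> x; apply: (@is_derive_affine _ _ _ g l (dl v)) => [h|]; first exact: ll.
  exact: is_derive1_direction.
- by exists (fun=> 0); [exact: RidgeCst|move=> x; exact: is_derive_cst].
- exists (fun x => f' x + g' x); first exact: RidgeAdd.
  by move=> x; exact: is_deriveD (df x) (dg x).
- exists (fun x => f' x * g x + f x * g' x).
    by apply: RidgeAdd; exact: RidgeMul.
  by move=> x; exact: is_derive_mulf (df x) (dg x).
Qed.

Lemma ridge_smooth {V : normedModType R} (f : V -> R) : ridge_algebra f -> smooth f.
Proof.
apply: smooth_of_class; first exact: ridge_continuous.
by move=> {}f v; exact: ridge_derive.
Qed.

Lemma ridge_prod {V : normedModType R} {I : Type} (s : seq I) (f : I -> V -> R) :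
  (forall i, ridge_algebra (f i)) -> ridge_algebra (fun x => \prod_(i <- s) f i x).
Proof.
move=> Hf; elim: s => [|i s IH].
  by under eq_fun do rewrite big_nil; exact: RidgeCst.
by under eq_fun do rewrite big_cons; exact: RidgeMul.
Qed.

End DerivativeClosed.

Section Sinc.
Context {R : realType}.

(** The n-th derivative of sinc, obtained by differentiating sinc u =
    \int_0^1 cos (u s) ds under the integral sign; each derivative of the
    cosine is a shift of the phase by pi / 2. *)
Definition sinc_moment (n : nat) (u : R) : R :=
  interval_integral 0 1 (fun s => s ^+ n * cos (u * s + pi / 2 *+ n)).

Lemma sinc_moment_derive n (u : R) :
  is_derive u (1 : R) (sinc_moment n) (sinc_moment n.+1 u).
Proof.
have cc k : continuous (fun z : R * R => z.2 ^+ k * cos (z.1 * z.2 + pi / 2 *+ k)).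
  apply: continuous_mulf.
    elim: k => [|k IH]; first by under eq_fun do rewrite expr0; exact: continuous_cstf.
    under eq_fun do rewrite exprS.
    by apply: continuous_mulf => //; apply: continuous_sndf; exact: continuous_idf.
  apply: (continuous_compf (@continuous_cos R)).
  apply: continuous_addf; last exact: continuous_cstf.
  by apply: continuous_mulf; [apply: continuous_fstf|apply: continuous_sndf];
     exact: continuous_idf.
apply: (io_derive (interval_integralP 0 1)
   (g := fun u s => s ^+ n * cos (u * s + pi / 2 *+ n))
   (g' := fun u s => s ^+ n.+1 * cos (u * s + pi / 2 *+ n.+1))).
- by near=> t; exact: (@continuous_slicer R R R
    (fun u s => s ^+ n * cos (u * s + pi / 2 *+ n)) t (cc n)).
- exact: cc.
- near=> t => s.
  have dl : is_derive (t : R) (1 : R) (fun t : R => t * s + pi / 2 *+ n) s.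
    have := is_deriveD (is_derive_mulf (is_derive_id (t : R) (1 :
        R)) (is_derive_cst s t 1))
       (is_derive_cst (pi / 2 *+ n : R) t 1).
    by rewrite mul1r mulr0 !addr0.
  have dc := @is_derive1_comp R cos (fun t => t * s + pi / 2 *+ n) t _ _
      (is_derive_cos _) dl.
  have := is_derive_mulf (is_derive_cst (s ^+ n) t 1) dc.
  rewrite mul0r add0r [pi / 2 *+ n.+1]mulrSr addrA cosDpihalf exprSr.
  by rewrite -mulrA [s * _]mulrC.
Unshelve. all: by end_near. Qed.

Lemma sinc_integral (u : R) : sinc u = sinc_moment 0 u.
Proof.
rewrite /sinc_moment.
rewrite (io_local (interval_integralP 0 1) (g := fun s => cos (u * s))); last first.
  by move=> s _; rewrite expr0 mul1r mulr0n addr0.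
have cc : continuous (fun s : R => cos (u * s)).
  apply: (continuous_compf (@continuous_cos R)).
  by apply: continuous_mulf; [exact: continuous_cstf|exact: continuous_idf].
have m1 : (-1 : R) < 0 by lra.
rewrite /sinc; case: eqVneq => [u0|u0].
  have did (s : R) : -1 < s -> is_derive s (1 : R) id (cos (u * s)).
    by move=> _; rewrite u0 mul0r cos0; exact: is_derive_id.
  by rewrite (interval_FTC2 m1 ler01 cc did) subr0.
have dF (s : R) : -1 < s -> is_derive s (1 : R) (fun s =>
    sin (u * s) * u^-1) (cos (u * s)).
  move=> _.
  have dl : is_derive (s : R) (1 : R) (fun s : R => u * s) u.
    have := is_derive_mulf (is_derive_cst u s 1) (is_derive_id (s : R) (1 : R)).
    by rewrite mul0r add0r mulr1.
  have ds := @is_derive1_comp R sin (fun s => u * s) s _ _ (is_derive_sin _) dl.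
  have := is_derive_mulf ds (is_derive_cst (u^-1) s 1).
  by rewrite mulr0 addr0 mulfK.
by rewrite (interval_FTC2 m1 ler01 cc dF) mulr1 mulr0 sin0 mul0r subr0.
Qed.

Lemma smooth1_sinc : smooth1 (@sinc R).
Proof.
exists [set f | exists n, f = sinc_moment n].
  by exists 0%N; apply/funext => u; exact: sinc_integral.
move=> _ [n ->]; exists (sinc_moment n.+1); first by exists n.+1.
by move=> s; exact: sinc_moment_derive.
Qed.

Lemma ridge_delta (d : nat) (b : R) : ridge_algebra (@delta R d b).
Proof.
rewrite /delta; apply: ridge_prod => i; apply: RidgeMul; first exact: RidgeCst.
apply: (Ridge (@sinc R) (fun z : 'rV[R]_d => pi * z 0 i / b)
   (fun v => pi * v 0 i / b) smooth1_sinc).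
  apply: continuous_mulf; last exact: continuous_cstf.
  apply: continuous_mulf; first exact: continuous_cstf.
  by apply: continuous_coordf; exact: continuous_idf.
by move=> h v x; rewrite !mxE; ring.
Qed.

Lemma smooth_delta (d : nat) (b : R) : smooth (@delta R d b).
Proof. exact/ridge_smooth/ridge_delta. Qed.

Lemma sincN (u : R) : sinc (- u) = sinc u.
Proof.
by rewrite /sinc oppr_eq0; case: eqVneq => // u0; rewrite sinN invrN mulrNN.
Qed.

Lemma deltaN (d : nat) (b : R) (z : 'rV[R]_d) : delta b (- z) = delta b z.
Proof.
by apply: eq_bigr => i _; rewrite mxE mulrN mulNr sincN.
Qed.
End Sinc.

Section Bump.
Context {R : realType}.

(** For k = 0 the classical smooth function that is flat at 0. The extra
    powers of 1 / s make the family stable under derivation up to linear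
    combinations. *)
Definition flat (k : nat) (s : R) : R :=
  if 0 < s then s^-1 ^+ k * expR (- s^-1) else 0.

Lemma flat_ge0 k s : 0 <= flat k s.
Proof.
by rewrite /flat; case: ifP => // s0; rewrite mulr_ge0 ?expR_ge0// exprn_ge0//
    invr_ge0 ltW.
Qed.

Lemma flat_gt0 k s : 0 < s -> 0 < flat k s.
Proof. by move=> s0; rewrite /flat s0 mulr_gt0 ?expR_gt0// exprn_gt0// invr_gt0. Qed.

Lemma flat_le0 k s : s <= 0 -> flat k s = 0.
Proof. by move=> s0; rewrite /flat ltNge s0. Qed.

(** With y = 1 / s this is y^k / k! <= exp y, a term of the exponential
    series. *)
Lemma flat_bound k s : flat k s <= k`!%:R.
Proof.
rewrite /flat; case: ifP => // s0.
rewrite expRN ler_pdivrMr ?expR_gt0//.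
have y0 : 0 <= s^-1 by rewrite invr_ge0 ltW.
case: k => [|k].
  by rewrite expr0 mul1r -[leLHS](expR0) ler_expR.
have := expR_ge1Dxn k y0.
have f0 : 0 < (k.+1)`!%:R :> R by rewrite ltr0n fact_gt0.
move=> h; rewrite mulrC -ler_pdivrMr//; apply: le_trans h.
by rewrite lerDr.
Qed.

Lemma flat_pos_derive k (s : R) : 0 < s ->
  is_derive s (1 : R) (fun s => s^-1 ^+ k * expR (- s^-1))
    (- k%:R * (s^-1 ^+ k.+1 * expR (- s^-1)) + s^-1 ^+ k.+2 * expR (- s^-1)).
Proof.
move=> s0; have sn0 : s != 0 by rewrite gt_eqF.
have dinv : is_derive s (1 : R) (fun s : R => s^-1) (- s^-1 ^+ 2).
  have := @is_derive_invf R R (1 : R) s id 1 sn0 (is_derive_id s (1 : R)).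
  by rewrite mulr1 exprVn.
have dN : is_derive s (1 : R) (fun s : R => - s^-1) (s^-1 ^+ 2).
  by have := is_deriveN dinv; rewrite opprK.
have de := @is_derive1_comp R expR (fun s => - s^-1) s _ _ (is_derive_expR _) dN.
elim: k => [|k IH].
  have := is_derive_mulf (is_derive_cst (1 : R) s 1) de.
  by rewrite mul0r add0r mul1r oppr0 mul0r add0r [expR _ * _]mulrC.
have := is_derive_mulf dinv IH.
have -> : (fun x : R => x^-1 * (x^-1 ^+ k * expR (- x^-1))) =
   (fun x => x^-1 ^+ k.+1 * expR (- x^-1)).
  by apply/funext => x; rewrite exprS mulrA.
congr is_derive; rewrite -[k.+1%:R]natr1 !exprS; ring.
Qed.

(** At 0 the difference quotient of [flat k] is [h * flat k.+2 h], which
    tends to 0 because [flat k.+2] is bounded. *)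
Lemma flat_derive k (s : R) :
  is_derive s (1 : R) (flat k) (- k%:R * flat k.+1 s + flat k.+2 s).
Proof.
have [s0|s0|s0] := ltgtP 0 s.
- rewrite /flat s0; apply: is_derive_near_eq (flat_pos_derive k s s0).
  near=> t; rewrite ifT//.
  by near: t; exact: lt_nbhsr.
- rewrite !flat_le0 ?(ltW s0)// mulr0 addr0.
  apply: is_derive_near_eq (is_derive_cst (0 : R) s 1).
  near=> t; rewrite flat_le0// ltW//.
  by near: t; exact: lt_nbhsl.
- rewrite -s0 !flat_le0// mulr0 addr0.
  suff H : h^-1 *: (flat k (h *: 1 + 0) - flat k 0) @[h --> 0^'] --> (0 : R).
    have D : derivable (flat k) 0 (1 : R) by apply/cvg_ex; exists 0.
    by split => //; apply: cvg_lim.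
  apply/cvgrPdist_le => e e0.
  have f0 : 0 < (k.+2)`!%:R :> R by rewrite ltr0n fact_gt0.
  near=> h.
  have h0 : h != 0 by near: h; exact: nbhs_dnbhs_neq.
  have he : `|h| < e / (k.+2)`!%:R by near: h; apply: dnbhs0_lt; rewrite divr_gt0.
  rewrite sub0r normrN addr0 [h *: 1]mulr1 (flat_le0 k 0)// subr0.
  have [hp|hn] := ltP 0 h; last by rewrite flat_le0// scaler0 normr0 ltW.
  have -> : h^-1 *: flat k h = h * flat k.+2 h.
    rewrite /flat hp /GRing.scale /= !exprS; field; exact: h0.
  rewrite normrM (ger0_norm (flat_ge0 _ _)).
  apply: (@le_trans _ _ (`|h| * (k.+2)`!%:R)); first by rewrite ler_wpM2l ?flat_bound.
  by rewrite -ler_pdivlMr// ltW.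
Unshelve. all: by end_near. Qed.

Inductive flat_span : (R -> R) -> Prop :=
| FlatGen k : flat_span (flat k)
| FlatAdd f g of flat_span f & flat_span g : flat_span (fun s => f s + g s)
| FlatScale a f of flat_span f : flat_span (fun s => a * f s).

Lemma smooth1_flat k : smooth1 (flat k).
Proof.
exists [set f | flat_span f] => [/=|f]; first exact: FlatGen.
elim=> [{}k|{}f g _ [f' Sf' df] _ [g' Sg' dg]|a {}f _ [f' Sf' df]].
- exists (fun s => - k%:R * flat k.+1 s + flat k.+2 s); last exact: flat_derive.
  by apply: FlatAdd; [apply: FlatScale|]; exact: FlatGen.
- exists (fun s => f' s + g' s); first exact: FlatAdd.
  by move=> s; exact: is_deriveD (df s) (dg s).
- exists (fun s => a * f' s); first exact: FlatScale.
  move=> s; have := is_derive_mulf (is_derive_cst a s 1) (df s).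
  by rewrite mul0r add0r.
Qed.

(** A smooth function, positive exactly on the open interval of radius [e]
    around [a]. *)
Definition interval_bump (e a s : R) : R := flat 0 (e - (s - a)) * flat 0 (e + (s - a)).

Lemma interval_bump_ge0 e a s : 0 <= interval_bump e a s.
Proof. by rewrite mulr_ge0 ?flat_ge0. Qed.

Lemma interval_bump_gt0 e a : 0 < e -> 0 < interval_bump e a a.
Proof. by move=> e0; rewrite mulr_gt0 ?flat_gt0// subrr ?subr0 ?addr0. Qed.

Lemma interval_bump_eq0 e a s : e <= `|s - a| -> interval_bump e a s = 0.
Proof.
rewrite ler_normr /interval_bump => /orP[h|h]; first by rewrite flat_le0 ?mul0r//
    subr_le0.
by rewrite (flat_le0 0 (e + (s - a))) ?mulr0//; lra.
Qed.

Context {d : nat}.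

(** A product of one-dimensional bumps, positive exactly on a cylinder
    around [(x0, t0)]. *)
Definition test_bump (e : R) (x0 : 'rV[R]_d) (t0 : R) : field R d :=
  fun x t => (\prod_i interval_bump e (x0 0 i) (x 0 i)) * interval_bump e t0 t.

Lemma ridge_interval_bump {V : normedModType R} (e a : R) (l dl : V ->
    R) : continuous l ->
  (forall (h : R) v x, l (h *: v + x) = h * dl v + l x) ->
  ridge_algebra (fun z => interval_bump e a (l z)).
Proof.
move=> cl ll; apply: RidgeMul.
- apply: (Ridge (flat 0) (fun z => e - (l z - a)) (fun v => - dl v) (smooth1_flat 0)).
    apply: continuous_subf; first exact: continuous_cstf.
    by apply: continuous_subf => //; exact: continuous_cstf.
  by move=> h v x; rewrite ll; ring.
- apply: (Ridge (flat 0) (fun z => e + (l z - a)) dl (smooth1_flat 0)).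
    apply: continuous_addf; first exact: continuous_cstf.
    by apply: continuous_subf => //; exact: continuous_cstf.
  by move=> h v x; rewrite ll; ring.
Qed.

Lemma smooth_test_bump e x0 t0 : smooth (on_pairs (test_bump e x0 t0)).
Proof.
apply: ridge_smooth; apply: RidgeMul.
  apply: ridge_prod => i; apply: (@ridge_interval_bump ('rV[R]_d * R)%type e
      (x0 0 i) (fun z => z.1 0 i) (fun v => v.1 0 i)).
    by apply: continuous_coordf; apply: continuous_fstf; exact: continuous_idf.
  by move=> h v x; rewrite /= !mxE.
apply: (@ridge_interval_bump ('rV[R]_d * R)%type e t0 snd snd) => //.
by apply: continuous_sndf; exact: continuous_idf.
Qed.

Lemma test_bump_ge0 (e : R) (x0 : 'rV[R]_d) (t0 : R) (x : 'rV[R]_d) (t : R) :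
    0 <= test_bump e x0 t0 x t.
Proof. by rewrite mulr_ge0 ?interval_bump_ge0// prodr_ge0// => i _;
    exact: interval_bump_ge0. Qed.

Lemma test_bump_gt0 (e : R) (x0 : 'rV[R]_d) (t0 : R) : 0 < e ->
    0 < test_bump e x0 t0 x0 t0.
Proof. by move=> e0; rewrite mulr_gt0 ?interval_bump_gt0// prodr_gt0// => i _;
    exact: interval_bump_gt0. Qed.

Lemma test_bump_eq0 (e : R) (x0 : 'rV[R]_d) (t0 : R) (x : 'rV[R]_d) (t : R) :
  ~ ((forall i, `|x 0 i - x0 0 i| < e) /\ `|t - t0| < e) -> test_bump e x0 t0 x t = 0.
Proof.
move=> /not_andP[/existsNP[i /negP]|/negP]; rewrite -leNgt => h; rewrite /test_bump.
  by rewrite (bigD1 i)//= interval_bump_eq0// !mul0r.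
by rewrite (interval_bump_eq0 _ _ t)// mulr0.
Qed.

(** The closed cylinder, a compact set that contains the support of the
    bump. *)
Definition cylinder (e : R) (x0 : 'rV[R]_d) (t0 : R) : set ('rV[R]_d * R) :=
  [set x : 'rV[R]_d | forall i, `[x0 0 i - e, x0 0 i + e]%classic (x 0 i)] `*`
  `[t0 - e, t0 + e]%classic.

Lemma cylinder_compact e x0 t0 : compact (cylinder e x0 t0).
Proof.
apply: compact_setX; last exact: segment_compact.
exact: (@rV_compact R d (fun i => `[x0 0 i - e, x0 0 i + e]%classic)
  (fun i => @segment_compact R _ _)).
Qed.

Lemma cylinderP (e : R) (x0 : 'rV[R]_d) (t0 : R) (x : 'rV[R]_d) (t : R) :
    (forall i, `|x 0 i - x0 0 i| < e) /\ `|t - t0| < e ->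
  cylinder e x0 t0 (x, t).
Proof.
move=> [hx ht]; split => /= [i|]; rewrite in_itv/=.
  by have := hx i; rewrite ltr_norml => /andP[? ?]; apply/andP; split; lra.
by move: ht; rewrite ltr_norml => /andP[? ?]; apply/andP; split; lra.
Qed.

Lemma C0infty_test_bump e x0 t0 : C0infty (test_bump e x0 t0).
Proof.
split; first exact: smooth_test_bump.
exists (cylinder e x0 t0); first exact: cylinder_compact.
by move=> x t nK; apply: test_bump_eq0 => /cylinderP.
Qed.

Lemma C0infty_pos_test_bump e x0 t0 : e < t0 -> C0infty_pos (test_bump e x0 t0).
Proof.
move=> et0; split; first exact: smooth_test_bump.
exists (cylinder e x0 t0); first exact: cylinder_compact.
split; first by move=> x t [_] /=; rewrite in_itv/= => /andP[+ _]; lra.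
by move=> x t nK; apply: test_bump_eq0 => /cylinderP.
Qed.
End Bump.

(** * Fields and their separation by test functions *)

Section Fields.
Context {R : realType} {d : nat}.
Implicit Types (f g p ps : field R d).

Lemma continuous_on_pairs_app {Z : topologicalType} {f : field R d} {x : Z ->
    'rV[R]_d} {t : Z -> R} :
  continuous (on_pairs f) -> continuous x -> continuous t -> continuous (fun z =>
      f (x z) (t z)).
Proof. by move=> cf cx ct; exact: (@continuous_app2 _ _ _ _ f x t cf cx ct). Qed.

Lemma on_pairs_slice {f : field R d} (t : R) :
  continuous (on_pairs f) -> continuous (fun x => f x t).
Proof. by move=> cf; exact: (@continuous_slicel _ _ _ f t cf). Qed.

Lemma on_pairs_swap {f : field R d} :
  continuous (on_pairs f) -> continuous (fun z : R * 'rV[R]_d => f z.2 z.1).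
Proof. by move=> cf; exact: (@continuous_swapf _ _ _ f cf). Qed.

Lemma box_field_continuous {M : R} {f : field R d} :
  continuous (on_pairs f) -> continuous (fun t => box_integral M d (fun x => f x t)).
Proof.
move=> cf; exact: (io_continuous (box_integralP M d) (f := fun t x =>
    f x t) (on_pairs_swap cf)).
Qed.

Lemma compact_field_support {K : set ('rV[R]_d * R)} : compact K ->
  exists2 M, 0 <= M & forall x t, K (x, t) -> box M d x.
Proof.
move=> cK; have /compact_sub_box[M M0 HM] : compact (fst @` K).
  apply: continuous_compact => //; apply: continuous_subspaceT.
  by apply: continuous_fstf; exact: continuous_idf.
by exists M => // x t Kxt; apply: HM; exists (x, t).
Qed.

Lemma C0infty_vanish {f : field R d} : C0infty f ->
  exists2 M, 0 <= M & forall t, vanish_off M (fun x => f x t).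
Proof.
move=> [_ [K /compact_field_support[M M0 HM] fK]]; exists M => // t x nx.
by apply: fK => /HM.
Qed.

Lemma C0infty_posW {f : field R d} : C0infty_pos f -> C0infty f.
Proof. by move=> [sf [K cK [_ fK]]]; split => //; exists K. Qed.

Lemma smooth_Ck {V : normedModType R} {f : V -> R} k : smooth f -> Ck k f.
Proof. by apply. Qed.

Lemma smooth_continuous {V : normedModType R} {f : V -> R} : smooth f -> continuous f.
Proof. by move=> /(_ 0%N [::] isT)[]. Qed.

Lemma C0infty_continuous {f : field R d} : C0infty f -> continuous (on_pairs f).
Proof. by move=> [/smooth_continuous]. Qed.

(** Both sides are integrals of the same extension by zero. *)
Lemma Rintegral_sub_support {D D' : set R} {F : R -> R} : D' `<=` D ->
  (forall t, D t -> ~ D' t -> F t = 0) ->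
  \int[@lebesgue_measure R]_(t in D) F t = \int[@lebesgue_measure R]_(t in D') F t.
Proof.
move=> DD F0; rewrite Rintegral_mkcond [RHS]Rintegral_mkcond;
    apply: eq_Rintegral => t _.
rewrite !patchE; case: ifPn => [|/negP tD].
  rewrite inE => tD; case: ifPn => // /negP tD'; apply: F0 => // ?.
  by apply: tD'; rewrite inE.
by case: ifPn => //; rewrite inE => /DD tD'; exfalso; apply: tD; rewrite inE.
Qed.

Lemma st_form_box {w : 'rV[R]_d -> R} {I : set R} {f g : field R d} {M : R} :
  (forall t, vanish_off M (fun x => f x t)) ->
  st_form w I f g = \int[@lebesgue_measure R]_(t in I)
    box_integral M d (fun x => f x t * g x t * w x).
Proof.
move=> f0; apply: eq_Rintegral => t _; apply: integral_Rn_box => x nx.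
by rewrite f0// !mul0r.
Qed.

Lemma continuous_weighted {w : 'rV[R]_d -> R} {f g : field R d} : continuous w ->
  continuous (on_pairs f) -> continuous (on_pairs g) ->
  continuous (on_pairs (fun x t => f x t * g x t * w x)).
Proof.
move=> cw cf cg; apply: continuous_mulf; first exact: continuous_mulf cf cg.
by apply: (continuous_compf cw); apply: continuous_fstf; exact: continuous_idf.
Qed.

Lemma test_bump_vanish (e : R) (x0 : 'rV[R]_d) (t0 : R) :
  exists2 M, 0 <= M & (forall i, - M < x0 0 i < M) /\
    (forall t, vanish_off M (fun x => test_bump e x0 t0 x t)).
Proof.
have [M0 M00 H] := compact_field_support (cylinder_compact e x0 t0).
have [M1 M10 H1] := compact_sub_box (@compact_set1 _ x0).
pose M := M0 + M1 + 1; exists M; first by rewrite /M; lra.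
split.
  by move=> i; have := H1 x0 erefl i => /andP[? ?]; apply/andP; rewrite /M; split; lra.
move=> t x nx; apply: test_bump_eq0 => /cylinderP/H Mx; apply: nx => i.
by have := Mx i => /andP[? ?]; apply/andP; rewrite /M; split; lra.
Qed.

Section Separation.
Context {w : 'rV[R]_d -> R} {I : set R}.
Hypotheses (cw : continuous w) (w0 : forall x, 0 < w x).

(** If [g1] exceeded [g2] at the point, it would do so on a cylinder around
    it, and the pairing with a bump supported there would be larger for [g1]
    than for [g2]. *)
Lemma st_form_separates_le {g1 g2 : field R d} {x0 : 'rV[R]_d} {t0 e0 : R} :
  continuous (on_pairs g1) -> continuous (on_pairs g2) -> 0 < e0 ->
  (forall t, t0 - e0 <= t <= t0 + e0 -> I t) ->
  (forall e, 0 < e <= e0 -> st_form w I (test_bump e x0 t0) g1 =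
     st_form w I (test_bump e x0 t0) g2) ->
  g1 x0 t0 <= g2 x0 t0.
Proof.
move=> c1 c2 e00 HI Hst; rewrite leNgt; apply/negP => g21.
have cdiff : continuous (fun z : 'rV[R]_d * R => g1 z.1 z.2 - g2 z.1 z.2).
  exact: continuous_subf c1 c2.
have [[A B] [/= Ax Bt] AB] : \forall z \near ((x0, t0) : 'rV[R]_d * R),
    0 < g1 z.1 z.2 - g2 z.1 z.2.
  have d0 : 0 < g1 x0 t0 - g2 x0 t0 by rewrite subr_gt0.
  exact: (cvgr_gt _ (cdiff (x0, t0))).
have /nbhs_ballP[eA /= eA0 HA] := Ax.
have /nbhs_ballP[eB /= eB0 HB] := Bt.
(* The cylinder of radius e lies in the neighbourhood A x B where g2 < g1,
   and its times lie in I. *)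
pose e := Num.min e0 (Num.min eA eB).
have ep : 0 < e by rewrite !lt_min e00 eA0 eB0.
have ee0 : e <= e0 by rewrite ge_min lexx.
have eeA : e <= eA by rewrite !ge_min lexx orbT.
have eeB : e <= eB by rewrite !ge_min lexx !orbT.
pose psi := test_bump e x0 t0.
have pos x t : 0 <= psi x t * (g1 x t - g2 x t) * w x.
  have [h|/test_bump_eq0 h] := pselect ((forall i, `|x 0 i - x0 0 i| < e) /\ `|t -
      t0| < e);
    last by rewrite /psi h !mul0r.
  apply: mulr_ge0; last exact: ltW.
  apply: mulr_ge0; first exact: test_bump_ge0.
  case: h => hx ht; apply: ltW.
  suff xtAB : (A `*` B) (x, t) by have := AB _ xtAB.
  split => /=.
    apply: HA; split => // i j; rewrite ord1 -ball_normE /= distrC.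
    exact: lt_le_trans (hx j) eeA.
  by apply: HB; rewrite -ball_normE /= distrC; exact: lt_le_trans ht eeB.
have cpsi : continuous (on_pairs psi) by apply: smooth_continuous;
    exact: smooth_test_bump.
have [M M0 [x0M psiM]] := test_bump_vanish e x0 t0.
have cF g : continuous (on_pairs g) ->
    continuous (fun t => box_integral M d (fun x => psi x t * g x t * w x)).
  by move=> cg; apply: box_field_continuous; exact: continuous_weighted.
have stE g : st_form w I psi g = interval_integral (t0 - e) (t0 + e)
    (fun t => box_integral M d (fun x => psi x t * g x t * w x)).
  rewrite (st_form_box psiM); apply: Rintegral_sub_support.
    move=> t /=; rewrite in_itv/= => /andP[h1 h2]; apply: HI.
    by apply/andP; split; lra.
  move=> t _ nt; apply: (io_eq0 (box_integralP M d)) => x _.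
  rewrite /psi test_bump_eq0 ?mul0r// => -[_ ht]; apply: nt; rewrite /= in_itv/=.
  by move: ht; rewrite ltr_norml => /andP[? ?]; apply/andP; split; lra.
have := Hst e _; rewrite ep ee0 => /(_ isT); rewrite !stE => /eqP.
rewrite -subr_eq0 -(io_sub (interval_integralP _ _)); [|exact: cF..].
apply/negP; rewrite gt_eqF//.
have E t : box_integral M d (fun x => psi x t * g1 x t * w x) -
    box_integral M d (fun x => psi x t * g2 x t * w x) =
    box_integral M d (fun x => psi x t * (g1 x t - g2 x t) * w x).
  rewrite -(io_sub (box_integralP M d)).
  - by apply: (io_local (box_integralP M d)) => x _; ring.
  - exact: (on_pairs_slice t (continuous_weighted cw cpsi c1)).
  - exact: (on_pairs_slice t (continuous_weighted cw cpsi c2)).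
have cd : continuous (on_pairs (fun x t => g1 x t - g2 x t)) by [].
apply: (@interval_integral_gt0 _ _ _ t0).
- by apply: continuous_subf; exact: cF.
- by move=> t _; rewrite E; apply: (io_ge0 (box_integralP M d));
    [exact: (on_pairs_slice t (continuous_weighted cw cpsi cd))|move=> x _; exact: pos].
- by apply/andP; split; lra.
- rewrite E; apply: (@box_integral_gt0 _ _ _ _ x0) => //.
  + exact: (on_pairs_slice t0 (continuous_weighted cw cpsi cd)).
  + by rewrite mulr_gt0// mulr_gt0 ?subr_gt0//; exact: test_bump_gt0.
Qed.

Lemma st_form_separates {g1 g2 : field R d} {x0 : 'rV[R]_d} {t0 e0 : R} :
  continuous (on_pairs g1) -> continuous (on_pairs g2) -> 0 < e0 ->
  (forall t, t0 - e0 <= t <= t0 + e0 -> I t) ->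
  (forall e, 0 < e <= e0 -> st_form w I (test_bump e x0 t0) g1 =
     st_form w I (test_bump e x0 t0) g2) ->
  g1 x0 t0 = g2 x0 t0.
Proof.
move=> c1 c2 e00 HI H; apply/eqP; rewrite eq_le (st_form_separates_le c1 c2 e00 HI H).
by apply: (st_form_separates_le c2 c1 e00 HI) => e he; rewrite H.
Qed.
End Separation.

End Fields.

(** * Green identity in space and time *)

Section DeriveAlgebra.
Context {R : realType} {V : normedModType R}.

Lemma is_derive_oppf {v x : V} {f : V -> R} {a : R} :
  is_derive x v f a -> is_derive x v (fun x => - f x) (- a).
Proof. by move=> df; exact: is_deriveN df. Qed.

Lemma is_derive_subf {v x : V} {f g : V -> R} {a b : R} :
  is_derive x v f a -> is_derive x v g b -> is_derive x v (fun x => f x - g x) (a - b).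
Proof. by move=> df dg; exact: is_deriveB df dg. Qed.
End DeriveAlgebra.

Section SpaceTimeDerivatives.
Context {R : realType} {d : nat}.
Implicit Types (f : field R d).
Local Notation e i := (delta_mx 0 i : 'rV[R]_d).

Lemma is_derive_space {f : field R d} {v x : 'rV[R]_d} {t a : R} :
  is_derive (x, t) (v, 0 : R) (on_pairs f) a -> is_derive x v (fun x => f x t) a.
Proof.
apply: (@is_derive_affine R ('rV[R]_d * R)%type 'rV[R]_d (on_pairs f) (fun x =>
    (x, t))).
by move=> h; rewrite -[RHS]/(h *: v + x, h * 0 + t) mulr0 add0r.
Qed.

Lemma is_derive_time {f : field R d} {x : 'rV[R]_d} {t a : R} :
  is_derive (x, t) (0 : 'rV[R]_d, 1 : R) (on_pairs f) a -> is_derive t (1 : R) (f x) a.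
Proof.
apply: (@is_derive_affine R ('rV[R]_d * R)%type R (on_pairs f) (fun t => (x, t))).
by move=> h; rewrite -[RHS]/(h *: (0 : 'rV[R]_d) + x, h * 1 + t) scaler0 add0r.
Qed.

Lemma C1_slice {f : field R d} {v : 'rV[R]_d} (t : R) :
  C1_along (v, 0 : R) (on_pairs f) -> C1_along v (fun x => f x t).
Proof.
move=> Hf; have [cf _ cf'] := Hf.
apply: (C1_along_derive (df := fun x => 'D_(v, 0 : R) (on_pairs f) (x, t))).
- exact: on_pairs_slice.
- apply: (@on_pairs_slice _ _ (fun x t => 'D_(v, 0 : R) (on_pairs f) (x, t))).
  by rewrite /on_pairs; under eq_fun do rewrite -surjective_pairing.
- by move=> x; apply: is_derive_space; exact: C1_is_derive.
Qed.

Lemma C2_slice {f : field R d} (t : R) : Ck 2 (on_pairs f) ->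
  C2_along_basis (fun x => f x t).
Proof.
move=> H i; split; first exact/C1_slice/(Ck_C1 _ H).
pose g : field R d := fun x t => 'D_(e i, 0 : R) (on_pairs f) (x, t).
rewrite (_ : (fun x => 'D_(e i) (fun z => f z t) x) = (fun x => g x t)); last first.
  apply/funext => x.
  by have [_] := @is_derive_space f (e i) x t _ (C1_is_derive (Ck_C1 (e i, 0 :
      R) H) (x, t)).
apply: C1_slice.
have := Ck_C1 (e i, 0 : R) (Ck_derive (e i, 0 : R) H).
by congr C1_along; apply/funext => -[].
Qed.

(** The time derivative, as a directional derivative of the function of
    pairs, so that its regularity in (x, t) is inherited. *)
Definition dt f : field R d := fun x t => 'D_(0 : 'rV[R]_d, 1 : R) (on_pairs f) (x, t).

Lemma on_pairs_dt f : on_pairs (dt f) = fun z => 'D_(0 : 'rV[R]_d, 1 :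
    R) (on_pairs f) z.
Proof. by apply/funext => -[]. Qed.

Lemma dt_Ck {f : field R d} {k : nat} : Ck k.+1 (on_pairs f) -> Ck k (on_pairs (dt f)).
Proof. by rewrite on_pairs_dt => H; exact: (Ck_derive _ H). Qed.

Lemma dt_derive {f : field R d} {k : nat} : Ck k.+1 (on_pairs f) ->
  forall x (t : R), is_derive t (1 : R) (f x) (dt f x t).
Proof. by move=> H x t; apply: is_derive_time; exact: (C1_is_derive (Ck_C1 _ H)). Qed.

Lemma Ck_continuous {V : normedModType R} {k : nat} {f : V -> R} : Ck k f ->
    continuous f.
Proof. by move=> /(_ [::] isT)[]. Qed.

Lemma derive1_dt {f : field R d} {k : nat} : Ck k.+1 (on_pairs f) ->
  forall x t, derive1 (f x) t = dt f x t.
Proof. by move=> H x t; rewrite derive1E; have [_ ->] := dt_derive H x t. Qed.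

Lemma derive1n_dt {f : field R d} : Ck 2 (on_pairs f) ->
  forall x t, derive1n 2 (f x) t = dt (dt f) x t.
Proof.
move=> H x t.
have E : derive1 (f x) = dt f x by apply/funext => s; exact: (derive1_dt H x s).
by rewrite derive1nS derive1n1 E (derive1_dt (dt_Ck H) x t).
Qed.
End SpaceTimeDerivatives.

Section Reciprocity.
Context {R : realType} {d : nat}.
Variables (T : R) (c rho : 'rV[R]_d -> R).
Hypotheses (T0 : 0 < T) (Hc : forall x, 0 < c x) (cc : continuous c)
  (Hrho : forall x, 0 < rho x) (rho2 : Ck 2 rho).
Local Notation e i := (delta_mx 0 i : 'rV[R]_d).

Lemma Ck2_C2_along_basis {u : 'rV[R]_d -> R} : Ck 2 u -> C2_along_basis u.
Proof. by move=> H i; split; [exact: Ck_C1 H|exact: Ck_C1 (Ck_derive (e i) H)]. Qed.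

Let rhon x : rho x != 0. Proof. by rewrite gt_eqF. Qed.
Let Crho := Ck2_C2_along_basis rho2.

(** The integrand is the derivative of p (d/dt) g - g (d/dt) p for g t = ps
    x (T - t); the Cauchy conditions of p make this vanish at 0, those of ps
    at T. *)
Lemma time_reciprocity {p ps : field R d} (x : 'rV[R]_d) :
  Ck 2 (on_pairs p) -> Ck 2 (on_pairs ps) -> cauchy0 p -> cauchy0 ps ->
  interval_integral 0 T (fun t =>
    p x t * dt (dt ps) x (T - t) - dt (dt p) x t * ps x (T - t)) = 0.
Proof.
move=> p2 ps2 /(_ x)[p0 p0'] /(_ x)[ps0 ps0'].
rewrite (derive1_dt p2) in p0'; rewrite (derive1_dt ps2) in ps0'.
(* Reversing time changes the sign of the first derivative of ps. *)
pose F t := p x t * - dt ps x (T - t) - dt p x t * ps x (T - t).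
have revD (f f' : R -> R) : (forall s : R, is_derive s (1 : R) f (f' s)) ->
    forall s : R, is_derive s (1 : R) (fun s => f (T - s)) (- f' (T - s)).
  move=> df s.
  have dl : is_derive s (1 : R) (fun s : R => T - s) (-1).
    have := is_deriveB (is_derive_cst T s 1) (is_derive_id (s : R) (1 : R)).
    by rewrite sub0r.
  have := @is_derive1_comp R f (fun s => T - s) s _ _ (df _) dl.
  by rewrite mulrN1.
have dF (t : R) : -1 < t -> is_derive t (1 : R) F
    (p x t * dt (dt ps) x (T - t) - dt (dt p) x t * ps x (T - t)).
  move=> _.
  have d1 := dt_derive p2 x t.
  have d2 := dt_derive (dt_Ck p2) x t.
  have d3 := revD _ _ (dt_derive ps2 x) t.
  have d4 := revD _ _ (dt_derive (dt_Ck ps2) x) t.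
  apply: (is_derive_eq (is_derive_subf (is_derive_mulf d1 (is_derive_oppf d4))
    (is_derive_mulf d2 d3))).
  move: (p x t) (dt p x t) (dt (dt p) x t) (ps x (T - t)) (dt ps x (T - t))
    (dt (dt ps) x (T - t)) => a0 a1 a2 b0 b1 b2.
  by ring.
have ct (f : field R d) : continuous (on_pairs f) -> continuous (fun t => f x t).
  by move=> cf; exact: (continuous_on_pairs_app cf (continuous_cstf x) continuous_idf).
have ctr (f : field R d) : continuous (on_pairs f) -> continuous (fun t => f x (T - t)).
  move=> cf; apply: (continuous_on_pairs_app cf (continuous_cstf x)).
  by apply: continuous_subf; [exact: continuous_cstf|exact: continuous_idf].
have cF' : continuous (fun t => p x t * dt (dt ps) x (T - t) - dt (dt p) x t * ps x
    (T - t)).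
  have c1 := ct _ (Ck_continuous p2).
  have c2 := ct _ (Ck_continuous (dt_Ck (dt_Ck p2))).
  have c3 := ctr _ (Ck_continuous ps2).
  have c4 := ctr _ (Ck_continuous (dt_Ck (dt_Ck ps2))).
  exact: (continuous_subf (continuous_mulf c1 c4) (continuous_mulf c2 c3)).
have m1 : (-1 : R) < 0 by lra.
rewrite (interval_FTC2 m1 (ltW T0) cF' dF) /F.
by rewrite subrr subr0 ps0 ps0' p0 p0' oppr0 !(mulr0, mul0r) !subr0.
Qed.

(** For each t the wave equations replace src and S; the spatial terms
    cancel by the symmetry of the operator for the weight [w], and the terms
    with time derivatives cancel after exchanging the integrals over t and
    x. *)
Lemma wave_reciprocity {kappa : R} {w : 'rV[R]_d -> R} {p S ps src : field R d} :
  (forall x, w x = kappa * (rho x)^-1) ->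
  C0infty p -> (forall x t, 0 <= t <= T -> wave_op c rho p x t = S x t) -> cauchy0 p ->
  C0infty S -> adjoint_wavefield c rho T src ps ->
  st_form w `[0, T] p src = st_form w `[0, T] S (fun x t => ps x (T - t)).
Proof.
move=> wE Cp waveP p0 CS [ps2 wavePs ps0].
have cw : continuous w.
  rewrite (_ : w = fun x => kappa * (rho x)^-1); last exact/funext.
  apply: continuous_mulf; first exact: continuous_cstf.
  by apply: continuous_invf => //; exact: Ck_continuous rho2.
have p2 : Ck 2 (on_pairs p) by case: Cp => + _; apply.
have cp := C0infty_continuous Cp; have cS := C0infty_continuous CS.
have [Mp Mp0 Hp] := C0infty_vanish Cp; have [MS MS0 HS] := C0infty_vanish CS.
(* The cube contains both supports, that of p strictly, so that p vanishes on
   its faces. *)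
pose M := Mp + MS + 1.
have M0 : 0 <= M by rewrite /M; lra.
have MpM : Mp < M by rewrite /M; lra.
have boxM x : ~ box M d x -> ~ box Mp d x /\ ~ box MS d x.
  by move=> nx; split => bx; apply: nx => i; have := bx i => /andP[? ?]; apply/andP;
    rewrite /M; split; lra.
have {}HpM t : vanish_off M (fun x => p x t) by move=> x /boxM[+ _]; exact: Hp.
have {}HS t : vanish_off M (fun x => S x t) by move=> x /boxM[_]; exact: HS.
have HB := box_integralP M d.
have HI := interval_integralP 0 T.
rewrite (st_form_box HpM) (st_form_box HS).
pose psr : field R d := fun x t => ps x (T - t).
pose psr2 : field R d := fun x t => dt (dt ps) x (T - t).
have crev (f : field R d) : continuous (on_pairs f) ->
    continuous (on_pairs (fun x t => f x (T - t))).
  move=> cf; apply: (continuous_on_pairs_app cf).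
    by apply: continuous_fstf; exact: continuous_idf.
  apply: continuous_subf; first exact: continuous_cstf.
  by apply: continuous_sndf; exact: continuous_idf.
have cpsr : continuous (on_pairs psr) by exact: crev (Ck_continuous ps2).
have cpsr2 : continuous (on_pairs psr2) by exact:
    crev (Ck_continuous (dt_Ck (dt_Ck ps2))).
have cptt : continuous (on_pairs (dt (dt p))) by exact:
    Ck_continuous (dt_Ck (dt_Ck p2)).
pose cw2 x := (c x ^+ 2)^-1 * w x.
have ccw2 : continuous cw2.
  apply: continuous_mulf => //; apply: continuous_invf.
    by move=> x; rewrite expf_neq0// gt_eqF.
  by under eq_fun do rewrite expr2; exact: continuous_mulf.
pose H x t := p x t * psr2 x t - dt (dt p) x t * psr x t.
have cH : continuous (on_pairs H).
  exact: (continuous_subf (continuous_mulf cp cpsr2) (continuous_mulf cptt cpsr)).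
have cHw : continuous (on_pairs (fun x t => H x t * cw2 x)).
  apply: continuous_mulf; first exact: cH.
  by apply: (continuous_compf ccw2); apply: continuous_fstf; exact: continuous_idf.
have cSw := continuous_weighted cw cS cpsr.
have key t : 0 <= t <= T -> box_integral M d (fun x => p x t * src x t * w x) =
    box_integral M d (fun x => S x t * psr x t * w x) +
    box_integral M d (fun x => H x t * cw2 x).
  move=> tT; have tT' : 0 <= T - t <= T by lra.
  have Cpt := C2_slice t p2; have Cpst : C2_along_basis (fun x =>
      psr x t) := C2_slice (T - t) ps2.
  (* A and B are the spatial terms; w rho = kappa turns their factor into a
     constant. *)
  pose A x := p x t * div_grad_inv rho (fun x => psr x t) x.
  pose B x := div_grad_inv rho (fun x => p x t) x * psr x t.
  have cA : continuous A.
    apply: continuous_mulf; first exact: on_pairs_slice.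
    exact: div_grad_inv_continuous.
  have cB : continuous B.
    apply: continuous_mulf; last exact: on_pairs_slice.
    exact: div_grad_inv_continuous.
  have AB : box_integral M d B = box_integral M d A.
    exact: (box_div_grad_inv_sym rhon Crho M0 MpM Cpt Cpst (or_introl (Hp t))).
  have c1 := on_pairs_slice t cSw; have c2 := on_pairs_slice t cHw.
  have cAB : continuous (fun x => kappa * (B x - A x)).
    by apply: continuous_mulf; [exact: continuous_cstf|exact: continuous_subf].
  rewrite -(io_add HB c1 c2).
  transitivity (box_integral M d (fun x => (S x t * psr x t * w x + H x t * cw2 x) +
    kappa * (B x - A x))).
    apply: (io_local HB) => x _.
    have -> : src x t = wave_op c rho ps x (T - t) by rewrite wavePs// opprB addrC
        subrK.
    rewrite -(waveP x t tT) /wave_op (derive1n_dt p2) (derive1n_dt ps2).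
    rewrite /A /B /H /cw2 /psr2 /psr wE.
    have := rhon x.
    move: (p x t) (dt (dt p) x t) (ps x (T - t)) (dt (dt ps) x (T - t)) (rho x)
      ((c x ^+ 2)^-1) (div_grad_inv rho (fun x => p x t) x)
      (div_grad_inv rho (fun x => ps x (T - t)) x) => a0 a2 b0 b2 rx cx dp dps rx0.
    by field.
  rewrite (io_add HB (continuous_addf c1 c2) cAB) (io_scale HB kappa
      (continuous_subf cB cA)).
  by rewrite (io_sub HB cB cA) AB subrr mulr0 addr0.
rewrite -!/(interval_integral 0 T _).
rewrite (io_local HI (g := fun t => box_integral M d (fun x => S x t * psr x t * w x) +
    box_integral M d (fun x => H x t * cw2 x))); last first.
  by move=> t /=; rewrite in_itv/=; exact: key.
rewrite (io_add HI); [|exact: box_field_continuous..].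
rewrite [X in _ + X](_ : _ = 0) ?addr0//.
have T00 : 0 <= T by exact: ltW.
rewrite (io_fubini_interval HB T00 (f := fun t x => H x t * cw2 x) (on_pairs_swap cHw)).
apply: (io_eq0 HB) => x _.
rewrite (io_scaler HI); last first.
  exact: (continuous_on_pairs_app cH (continuous_cstf x) continuous_idf).
by rewrite time_reciprocity ?mul0r.
Qed.
End Reciprocity.

(** * The adjoint of the reception operator *)

Section DirectionLinearity.
Context {R : realType} {V : normedModType R}.

Lemma mean_value_from0 {psi psi' : R -> R} (h : R) :
  (forall s : R, is_derive s (1 : R) psi (psi' s)) ->
  exists2 c, `|c| <= `|h| & psi h - psi 0 = psi' c * h.
Proof.
move=> dpsi.
have cpsi (a b : R) : {within `[a, b], continuous psi}.
  by apply: derivable_within_continuous => s _; have [] := dpsi s.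
have [h0|h0] := leP 0 h.
  have [c] := @MVT_segment R psi psi' 0 h h0 (fun s _ => dpsi s) (cpsi 0 h).
  rewrite in_itv/= subr0 => /andP[c0 ch] E; exists c => //.
  by rewrite !ger0_norm.
have [c] := @MVT_segment R psi psi' h 0 (ltW h0) (fun s _ => dpsi s) (cpsi h 0).
rewrite in_itv/= sub0r => /andP[ch c0] E; exists c.
  by rewrite ler0_norm// ltr0_norm// lerN2.
by rewrite -opprB E mulrN opprK.
Qed.

Lemma is_derive_scale_direction {f : V -> R} {v x : V} {a d : R} :
  is_derive x v f d -> is_derive x (a *: v) f (a * d).
Proof.
move=> df; pose phi (s : R) := s *: v + x.
have phi0 : phi 0 = x by rewrite /phi scale0r add0r.
have dphi : is_derive (0 : R) (1 : R) (fun s => f (phi s)) d.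
  apply: (@is_derive_affine R V R f phi v); last by rewrite phi0.
  by move=> h; rewrite phi0 /phi addr0 [h *: 1]mulr1.
have [] := is_derive1_direction (b := a) dphi; rewrite mulrC => D E.
have Q : (fun h : R => h^-1 *: ((f \o shift x) (h *: (a *: v)) - f x)) =
    (fun h : R => h^-1 *: (((fun s => f (phi s)) \o shift 0) (h *: a) - f (phi 0))).
  by apply/funext => h /=; rewrite phi0 /phi addr0 scalerA.
by split; [rewrite /derivable Q|rewrite /derive Q].
Qed.

(** The increment along [u + v] is an increment along [u], to which the mean
    value theorem and the continuity of the derivative along [u] apply,
    followed by one along [v]. *)
Lemma is_derive_add_direction {f : V -> R} {u v x : V} :
  C1_along u f -> C1_along v f -> is_derive x (u + v) f ('D_u f x + 'D_v f x).
Proof.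
move=> Hu Hv; have [_ _ cu] := Hu.
suff H : h^-1 *: (f (h *: (u + v) + x) - f x) @[h --> 0^'] --> ('D_u f x + 'D_v f x).
  have D : derivable f x (u + v) by apply/cvg_ex; exists ('D_u f x + 'D_v f x).
  by split => //; apply: cvg_lim.
have step h : h != 0 -> exists2 c, `|c| <= `|h| &
    h^-1 *: (f (h *: (u + v) + x) - f x) =
    'D_u f (c *: u + (h *: v + x)) + h^-1 *: (f (h *: v + x) - f x).
  move=> h0; pose w := h *: v + x.
  have dpsi (s : R) : is_derive s (1 : R) (fun s =>
      f (s *: u + w)) ('D_u f (s *: u + w)).
    apply: (@is_derive_affine R V R f (fun s => s *: u + w) u);
        last exact: C1_is_derive.
    by move=> k; rewrite [k *: 1]mulr1 scalerDl -addrA.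
  have [c ch E] := mean_value_from0 h dpsi; exists c => //.
  have -> : h *: (u + v) + x = h *: u + w by rewrite scalerDr -addrA.
  rewrite -/w.
  have -> : f (h *: u + w) - f x = 'D_u f (c *: u + w) * h + (f w - f x).
    by rewrite -E /= scale0r add0r subrKA.
  by rewrite /GRing.scale /=; field.
apply/cvgrPdist_le => e e0.
have e2 : 0 < e / 2 by rewrite divr_gt0.
have [_ dv _] := Hv.
have limv : h^-1 *: (f (h *: v + x) - f x) @[h --> 0^'] --> 'D_v f x by exact: dv.
move/cvgrPdist_le : limv => /(_ _ e2) limv.
have := cu x; move/cvgrPdist_le => /(_ _ e2)/nbhs_ballP[r /= r0 Hr].
near=> h.
have h0 : h != 0 by near: h; exact: nbhs_dnbhs_neq.
have [c ch ->] := step h h0.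
have hr : `|h| < r / (`|u| + `|v| + 1).
  by near: h; apply: dnbhs0_lt; rewrite divr_gt0// ltr_wpDl// addr_ge0.
have near_x : `|'D_u f x - 'D_u f (c *: u + (h *: v + x))| <= e / 2.
  apply: Hr; rewrite -ball_normE /= addrA opprD addrCA subrr addr0 normrN.
  apply: (le_lt_trans (ler_normD _ _)); rewrite !normrZ.
  apply: (@le_lt_trans _ _ (`|h| * (`|u| + `|v| + 1))).
    rewrite mulrDr mulr1 mulrDr -addrA lerD ?ler_wpM2r// lerDl//.
  by rewrite -ltr_pdivlMr// ltr_wpDl// addr_ge0.
rewrite opprD addrACA (le_trans (ler_normD _ _))// [leRHS]splitr lerD//.
by near: h.
Unshelve. all: by end_near. Qed.

(** This expands the normal derivative in partial derivatives. *)
Lemma derive_sum_direction {f : V -> R} {I : Type} (s : seq I) (a : I -> R) (v : I ->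
    V) (x : V) :
  (forall v, C1_along v f) ->
  'D_(\sum_(i <- s) a i *: v i) f x = \sum_(i <- s) a i * 'D_(v i) f x.
Proof.
move=> Hf; elim: s => [|i s IH]; first by rewrite !big_nil derive0.
rewrite !big_cons; have [_ ->] := is_derive_add_direction (x := x) (Hf (a i *: v i))
  (Hf (\sum_(i <- s) a i *: v i)).
by rewrite IH; have [_ ->] := is_derive_scale_direction (a := a i) (C1_is_derive (Hf
    (v i)) x).
Qed.
End DirectionLinearity.

Section Reception.
Context {R : realType} {d : nat}.
Variables (T b : R) (rho : 'rV[R]_d -> R) (Omega : set 'rV[R]_d) (r : receiver R d).
Hypotheses (Hrho : forall x, 0 < rho x) (rho2 : Ck 2 rho).
Hypothesis Hr : is_receiver b Omega r.
Local Notation e i := (delta_mx 0 i : 'rV[R]_d).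
Local Notation delta_b := (@delta R d b).

Let rhon x : rho x != 0. Proof. by rewrite gt_eqF. Qed.
Let Crho := Ck2_C2_along_basis rho2.
Let delta2 : Ck 2 delta_b. Proof. exact: smooth_delta. Qed.

Lemma translate_derive {u : 'rV[R]_d -> R} {v y x : 'rV[R]_d} : C1_along v u ->
  is_derive x v (fun z => u (z - y)) ('D_v u (x - y)).
Proof.
move=> Hu; apply: (@is_derive_affine R _ _ u (fun z => z - y) v).
  by move=> h; rewrite addrA.
exact: C1_is_derive.
Qed.

Lemma C1_translate {u : 'rV[R]_d -> R} {v : 'rV[R]_d} (y : 'rV[R]_d) : C1_along v u ->
  C1_along v (fun z => u (z - y)).
Proof.
move=> Hu; have [cu _ cu'] := Hu.
have ct : continuous (fun z : 'rV[R]_d => z - y).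
  by apply: continuous_subv; [exact: continuous_idf|exact: continuous_cstf].
apply: (C1_along_derive (df := fun z => 'D_v u (z - y))).
- exact: continuous_compf cu ct.
- exact: (continuous_compf cu' ct).
- by move=> z; exact: translate_derive.
Qed.

Lemma C2_translate {u : 'rV[R]_d -> R} (y : 'rV[R]_d) : C2_along_basis u ->
  C2_along_basis (fun z => u (z - y)).
Proof.
move=> Hu i; have [Hu1 Hu2] := Hu i; split; first exact: C1_translate.
rewrite (_ : (fun x => 'D_(e i) (fun z => u (z - y)) x) = (fun x =>
    'D_(e i) u (x - y))).
  exact: (C1_translate (u := fun x => 'D_(e i) u x)).
by apply/funext => x; have [_] := @translate_derive u (e i) y x Hu1.
Qed.

Let Cdelta := Ck2_C2_along_basis delta2.

(** The kernel against which the data are integrated in the adjoint source.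
    In the Dirichlet case the minus sign comes from the inward normal. *)
Definition source_kernel (k : bc_type) (x xs : 'rV[R]_d) : R :=
  match k with
  | Neumann => div_grad_inv rho (fun z => rho z * delta_b (z - xs)) x
  | Dirichlet => - \sum_i 'D_(e i) delta_b (x - xs) * rc_normal r 0 i
  end.

Lemma adjoint_sourceE k (y : field R d) x t : adjoint_source k rho b Omega r y x t =
  2^-1 * surface_integral Omega r (fun xs => source_kernel k x xs * y xs t).
Proof.
case: k => //=; congr (_ * surface_integral _ _ _); apply/funext => xs.
rewrite /dot mulNr mulr_suml -sumrN; apply: eq_bigr => i _; rewrite !mxE.
by have [_ ->] := @translate_derive delta_b (e i) xs x (Cdelta i).1; ring.
Qed.

(** Expanded form of nabla . ((1 / rho) nabla (rho delta)), from which the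
    joint continuity in [x] and [xs] can be read off. *)
Lemma neumann_kernelE x xs : source_kernel Neumann x xs =
  \sum_i ('D_(e i) (fun z => (rho z)^-1 * 'D_(e i) rho z) x * delta_b (x - xs) +
    (rho x)^-1 * 'D_(e i) rho x * 'D_(e i) delta_b (x - xs) +
    'D_(e i) (fun z => 'D_(e i) delta_b z) (x - xs)).
Proof.
rewrite /= div_grad_invE; apply: eq_bigr => i _.
have [Hrho1 Hrho2'] := Crho i; have [Hd1 Hd2] := Cdelta i.
have Hfl := C1_flux rhon Crho Crho i.
rewrite (_ : (fun z => (rho z)^-1 * 'D_(e i) (fun z => rho z * delta_b (z - xs)) z) =
   (fun z => (rho z)^-1 * 'D_(e i) rho z * delta_b (z - xs) + 'D_(e i) delta_b
       (z - xs))).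
  have d1 := is_derive_mulf (C1_is_derive Hfl x) (@translate_derive delta_b
      (e i) xs x Hd1).
  have d2 := @translate_derive (fun z => 'D_(e i) delta_b z) (e i) xs x Hd2.
  by have [_ ->] := is_deriveD d1 d2.
apply/funext => z.
have [_ ->] := is_derive_mulf (C1_is_derive Hrho1 z) (@translate_derive delta_b
    (e i) xs z Hd1).
by have := rhon z; move: (rho z) ('D_(e i) rho z) => a a' a0; field.
Qed.

Lemma source_kernel_continuous k :
  continuous (fun z : 'rV[R]_d * 'rV[R]_d => source_kernel k z.1 z.2).
Proof.
have cdiff : continuous (fun z : 'rV[R]_d * 'rV[R]_d => z.1 - z.2).
  by apply: continuous_subv; [apply: continuous_fstf|apply: continuous_sndf];
    exact: continuous_idf.
have cfst : continuous (fun z : 'rV[R]_d * 'rV[R]_d => z.1).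
  by apply: continuous_fstf; exact: continuous_idf.
have cdelta i : continuous (fun z => 'D_(e i) delta_b z) by have [[]] := Cdelta i.
case: k.
  rewrite (_ : (fun z => _) = (fun z : 'rV[R]_d * 'rV[R]_d =>
    \sum_i ('D_(e i) (fun z => (rho z)^-1 * 'D_(e i) rho z) z.1 * delta_b (z.1 - z.2) +
    (rho z.1)^-1 * 'D_(e i) rho z.1 * 'D_(e i) delta_b (z.1 - z.2) +
    'D_(e i) (fun z => 'D_(e i) delta_b z) (z.1 - z.2)))); last first.
    by apply/funext => z; exact: neumann_kernelE.
  apply: continuous_sumf => i.
  have [c1 _ c2] := C1_flux rhon Crho Crho i.
  have [[c3 _ _] [_ _ c4]] := Cdelta i.
  exact: (continuous_addf (continuous_addf
    (continuous_mulf (continuous_compf c2 cfst) (continuous_compf c3 cdiff))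
    (continuous_mulf (continuous_compf c1 cfst) (continuous_compf (cdelta i) cdiff)))
    (continuous_compf c4 cdiff)).
apply: continuous_oppf; apply: continuous_sumf => i.
exact: (continuous_mulf (continuous_compf (cdelta i) cdiff) (continuous_cstf _)).
Qed.

Lemma G_op_vanish k {f : field R d} {M t : R} : vanish_off M (fun x => f x t) ->
  vanish_off M (fun x => G_op k rho r f x t).
Proof.
move=> ft0 x nx; case: k => /=; last exact: (vanish_off_derive _ ft0 x nx).
rewrite div_grad_invE big1 ?mulr0// => i _.
apply: (vanish_off_derive (e i) _ x nx) => z nz.
by rewrite (vanish_off_derive (e i) ft0 z nz) mulr0.
Qed.

Lemma G_op_continuous k {f : field R d} (t : R) : smooth (on_pairs f) ->
  continuous (fun x => G_op k rho r f x t).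
Proof.
move=> sf; case: k => /=.
  apply: continuous_mulf; first exact: Ck_continuous rho2.
  exact: (div_grad_inv_continuous rhon Crho (C2_slice t (smooth_Ck 2 sf))).
by have [] := C1_slice t (Ck_C1 (rc_normal r, 0 : R) (smooth_Ck 1 sf)).
Qed.

(** In the Neumann case the symmetry of nabla . ((1 / rho) nabla) is applied
    to [f] and rho delta; in the Dirichlet case each partial derivative is
    integrated by parts. The delta is even, so its argument can be reversed. *)
Lemma receiver_box_duality k {f : field R d} {M0 M : R} (t : R) (xs : 'rV[R]_d) :
  smooth (on_pairs f) -> 0 <= M -> M0 < M -> vanish_off M0 (fun x => f x t) ->
  box_integral M d (fun x => delta_b (xs - x) * G_op k rho r f x t) =
  box_integral M d (fun x => source_kernel k x xs * f x t).
Proof.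
move=> sf Mge0 MM ft0; have HB := box_integralP M d.
have Cf : C2_along_basis (fun x => f x t) := C2_slice t (smooth_Ck 2 sf).
have Cd : C2_along_basis (fun z => delta_b (z - xs)) := C2_translate xs Cdelta.
have dE x : delta_b (xs - x) = delta_b (x - xs) by rewrite -opprB deltaN.
case: k => /=.
  have Crd := C2_along_mul Crho Cd.
  transitivity (box_integral M d (fun x => div_grad_inv rho (fun x => f x t) x *
      (rho x * delta_b (x - xs)))).
    by apply: (io_local HB) => x _; rewrite dE [RHS]mulrC -mulrA mulrCA.
  rewrite (box_div_grad_inv_sym rhon Crho Mge0 MM Cf Crd (or_introl ft0)).
  by apply: (io_local HB) => x _; rewrite mulrC.
have C1f v : C1_along v (fun x => f x t).
  exact: C1_slice (Ck_C1 _ (smooth_Ck 1 sf)).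
have nE : rc_normal r = \sum_i rc_normal r 0 i *: e i by exact: row_sum_delta.
have cf : continuous (fun x => f x t) by have [] := C1f 0.
have cd : continuous (fun x : 'rV[R]_d => delta_b (x - xs)).
  apply: (continuous_compf (Ck_continuous delta2)).
  by apply: continuous_subv; [exact: continuous_idf|exact: continuous_cstf].
have cdf i : continuous (fun x => 'D_(e i) (fun z => f z t) x) by have [] := C1f (e i).
have cdd i : continuous (fun x : 'rV[R]_d => 'D_(e i) delta_b (x - xs)).
  have [[_ _ cdi] _] := Cdelta i; apply: (continuous_compf cdi).
  by apply: continuous_subv; [exact: continuous_idf|exact: continuous_cstf].
transitivity (box_integral M d (fun x => \sum_i
    ('D_(e i) (fun z => f z t) x * delta_b (x - xs)) * rc_normal r 0 i)).
  apply: (io_local HB) => x _; rewrite dE {1}nE derive_sum_direction// mulr_sumr.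
  by apply: eq_bigr => i _; move: (delta_b _) ('D_(e i) _ x) => a a'; ring.
transitivity (box_integral M d (fun x => \sum_i
    - (f x t * 'D_(e i) delta_b (x - xs)) * rc_normal r 0 i)); last first.
  apply: (io_local HB) => x _; rewrite mulNr mulr_suml -sumrN.
  by apply: eq_bigr => i _; move: ('D_(e i) delta_b _) => a; ring.
rewrite !(io_sum HB); last 2 first.
- move=> i; apply: continuous_mulf; last exact: continuous_cstf.
  by apply: continuous_oppf; exact: continuous_mulf.
- by move=> i; apply: continuous_mulf; [exact: continuous_mulf|exact: continuous_cstf].
apply: eq_bigr => i _.
rewrite !(io_scaler HB); last 2 first.
- by apply: continuous_oppf; exact: continuous_mulf.
- exact: continuous_mulf.
congr (_ * _); rewrite (io_opp HB); last exact: continuous_mulf.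
have Cdi : C1_along (e i) (fun z => delta_b (z - xs)) by have [] := Cd i.
rewrite (box_by_parts Mge0 MM (C1f (e i)) Cdi); last first.
  by move=> x nx; rewrite ft0// mul0r.
have dtr x : 'D_(e i) (fun z => delta_b (z - xs)) x = 'D_(e i) delta_b (x - xs).
  by have [_] := @translate_derive delta_b (e i) xs x (Cdelta i).1.
exact: (congr1 -%R (io_local HB (fun x _ => congr1 (GRing.mul (f x t)) (dtr x)))).
Qed.

(** The density a_R is continuous on the surface only; it is extended by the
    theorem of Tietze, and the data are a_R times a continuous function. *)
Lemma surface_data_extension {y : field R d} : C0infty_bdry T Omega (scale_inv r y) ->
  exists2 Y : field R d, continuous (on_pairs Y) &
    forall x t, rc_surface Omega r x -> 0 <= t <= T -> y x t = Y x t.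
Proof.
move=> [G CG yG]; have [_ _ _ _ [ca a0 _]] := Hr.
have cS := rc_surface_compact b Omega r Hr.
have [M Mbound] : exists M, forall x, rc_surface Omega r x -> `|rc_a r x| <= M.
  have /compact_bounded[M [_ HM]] := continuous_compact ca cS.
  by exists (M + 1) => x Sx; apply: (HM (M + 1)); [rewrite ltrDl|exists x].
have M1 : 0 < Num.max M 1 by rewrite lt_max ltr01 orbT.
have [|g [ag cg _]] := @continuous_bounded_extension _ R pseudometric_normal _
  (rc_surface_closed Omega r) (rc_a r) _ M1 ca.
  by move=> x /Mbound h; rewrite le_max h.
exists (fun x t => g x * G x t).
  apply: continuous_mulf; last exact: C0infty_continuous CG.
  by apply: (continuous_compf (f := g) cg); apply: continuous_fstf;
      exact: continuous_idf.
move=> x t Sx tT; rewrite -ag ?inE// -yG//; last by case: Sx.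
by rewrite /scale_inv mulrA divff ?mul1r// gt_eqF// a0.
Qed.

Lemma surface_kernel_continuous k {Y : field R d} : continuous (on_pairs Y) ->
  continuous (on_pairs (fun x t =>
    2^-1 * surface_integral Omega r (fun xs => source_kernel k x xs * Y xs t))).
Proof.
move=> cY; apply: continuous_mulf; first exact: continuous_cstf.
pose F (z : 'rV[R]_d * R) xs := source_kernel k z.1 xs * Y xs z.2.
apply: (io_continuous (surface_integralP b Omega r Hr) (f := F)).
apply: continuous_mulf.
  apply: (@continuous_app2 _ _ _ _ (source_kernel k)
    (fun w : ('rV[R]_d * R) * 'rV[R]_d => w.1.1) snd (source_kernel_continuous k)).
    by do 2 apply: continuous_fstf; exact: continuous_idf.
  by apply: continuous_sndf; exact: continuous_idf.
apply: (@continuous_on_pairs_app _ _ (('rV[R]_d * R) * 'rV[R]_d)%type Y snd (fun w =>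
    w.1.2) cY).
  by apply: continuous_sndf; exact: continuous_idf.
by apply: continuous_sndf; apply: continuous_fstf; exact: continuous_idf.
Qed.

Lemma adjoint_source_extension k {y : field R d} :
    C0infty_bdry T Omega (scale_inv r y) ->
  exists2 h : field R d, continuous (on_pairs h) &
    forall x t, 0 <= t <= T -> adjoint_source k rho b Omega r y x t = h x t.
Proof.
move=> /surface_data_extension[Y cY yY].
exists (fun x t => 2^-1 * surface_integral Omega r (fun xs =>
    source_kernel k x xs * Y xs t)).
  exact: surface_kernel_continuous.
move=> x t tT; rewrite adjoint_sourceE; congr (_ * _).
by apply: (io_local (surface_integralP b Omega r Hr)) => xs Sxs; rewrite yY.
Qed.

(** After the cancellation of the factors a_R this is [receiver_box_duality]
    for each surface point, followed by an exchange of the surface integral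
    with the integral over space. *)
Lemma reception_duality k {y f : field R d} : C0infty_bdry T Omega (scale_inv r y) ->
  C0infty f ->
  bd_form T Omega r (scale_inv r (RG_op k rho b T Omega r f)) (scale_inv r y) =
  st_form (cst 1) `[0, T] f (adjoint_source k rho b Omega r y).
Proof.
move=> /surface_data_extension[Y cY yY] Cf.
have HS := surface_integralP b Omega r Hr.
have [_ _ _ _ [_ a0 _]] := Hr.
have [M0 M00 HM] := C0infty_vanish Cf; have [sf _] := Cf.
pose M := M0 + 1; have M0M : M0 < M by rewrite /M; lra.
have Mge0 : 0 <= M by rewrite /M; lra.
have boxM x : ~ box M d x -> ~ box M0 d x.
  by move=> nx bx; apply: nx => i; have := bx i => /andP[? ?]; apply/andP;
      rewrite /M; split; lra.
have HfM t : vanish_off M (fun x => f x t) by move=> x /boxM; exact: HM.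
have HB := box_integralP M d.
have cf := C0infty_continuous Cf.
have cK := source_kernel_continuous k.
rewrite (st_form_box HfM).
apply: eq_Rintegral => t; rewrite inE/= in_itv/= => tT.
transitivity (surface_integral Omega r (fun xs =>
    box_integral M d (fun x => 2^-1 * source_kernel k x xs * f x t * Y xs t))).
  apply: (io_local HS) => xs Sxs.
  have axs : rc_a r xs != 0 by rewrite gt_eqF// a0.
  have GM := G_op_vanish k (HfM t).
  have cG := G_op_continuous k t sf.
  have cdelta : continuous (fun x : 'rV[R]_d => delta_b (xs - x)).
    apply: (continuous_compf (Ck_continuous delta2)).
    by apply: continuous_subv; [exact: continuous_cstf|exact: continuous_idf].
  have ckx : continuous (fun x => source_kernel k x xs).
    exact: (continuous_slicel (f := source_kernel k) xs cK).
  have cft := on_pairs_slice t cf.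
  rewrite /scale_inv (yY _ _ Sxs tT) /RG_op /R_op ifT; last by apply/asboolP.
  rewrite (integral_Rn_box M); last by move=> x /GM ->; rewrite mulr0.
  rewrite (io_local HB (g := fun x => rc_a r xs * (delta_b
      (xs - x) * G_op k rho r f x t)));
    last by move=> x _; rewrite mulrA.
  rewrite (io_scale HB _ (continuous_mulf cdelta cG)).
  rewrite (receiver_box_duality k t xs sf Mge0 M0M (HM t)).
  rewrite (io_local HB (f := fun x => 2^-1 * source_kernel k x xs * f x t * Y xs t)
    (g := fun x => (2^-1 * Y xs t) * (source_kernel k x xs * f x t))); last first.
    by move=> x _; ring.
  rewrite (io_scale HB _ (continuous_mulf ckx cft)).
  move: (box_integral _ _ _) (Y xs t) axs => B y' axs; field; exact: axs.
pose F xs x := 2^-1 * source_kernel k x xs * f x t * Y xs t.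
have cF : continuous (fun z : 'rV[R]_d * 'rV[R]_d => F z.2 z.1).
  have cfst : continuous (fun z : 'rV[R]_d * 'rV[R]_d => z.1).
    by apply: continuous_fstf; exact: continuous_idf.
  have csnd : continuous (fun z : 'rV[R]_d * 'rV[R]_d => z.2).
    by apply: continuous_sndf; exact: continuous_idf.
  exact: (continuous_mulf (continuous_mulf (continuous_mulf (continuous_cstf (2^-1 :
      R)) cK)
    (continuous_on_pairs_app cf cfst (continuous_cstf (t : R))))
    (continuous_on_pairs_app cY csnd (continuous_cstf (t : R)))).
rewrite -(io_fubini_box M HS Mge0 (f := fun x xs => F xs x) cF).
apply: (io_local HB) => x _.
rewrite adjoint_sourceE /cst mulr1.
rewrite (io_local HS (f := fun xs => source_kernel k x xs * y xs t)
   (g := fun xs => source_kernel k x xs * Y xs t)); last first.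
  by move=> xs Sxs; rewrite yY.
rewrite (io_local HS (g := fun xs => (2^-1 * f x t) * (source_kernel k x xs * Y xs t)));
  last by move=> xs _; rewrite /F; ring.
rewrite (io_scale HS); first by ring.
apply: continuous_mulf; last exact: on_pairs_slice.
exact: (continuous_slicer (f := source_kernel k) x cK).
Qed.
End Reception.

(** * The adjoint of the forward operator *)

Section Extension.
Context {R : realType} {d : nat}.

Lemma within_continuous_comp {X Z : topologicalType} {A : set X} {f : X ->
    R} {phi : Z -> X} :
  {within A, continuous f} -> continuous phi -> (forall z, A (phi z)) ->
  continuous (fun z => f (phi z)).
Proof.
move=> /subspace_continuousP cf cphi Aphi z U Uf.
have := cphi z _ (cf _ (Aphi z) U Uf).
by rewrite /= !nbhs_simpl /=; apply: filterS => z'; apply.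
Qed.

Lemma continuous_eq_ends {f g : R -> R} {a b : R} : a < b -> continuous f ->
    continuous g ->
  (forall t, a < t < b -> f t = g t) -> f a = g a /\ f b = g b.
Proof.
move=> ab cf cg fg; split.
- apply: (@cvg_unique _ (@Rhausdorff R) (f @ a^'+)).
    by apply: cvg_at_right_filter; exact: cf.
  have : g @ a^'+ --> g a by apply: cvg_at_right_filter; exact: cg.
  apply: cvg_trans; apply: near_eq_cvg; near=> t; rewrite fg//.
  by apply/andP; split; near: t; [exact: nbhs_right_gt|exact: nbhs_right_lt].
- apply: (@cvg_unique _ (@Rhausdorff R) (f @ b^'-)).
    by apply: cvg_at_left_filter; exact: cf.
  have : g @ b^'- --> g b by apply: cvg_at_left_filter; exact: cg.
  apply: cvg_trans; apply: near_eq_cvg; near=> t; rewrite fg//.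
  by apply/andP; split; near: t; [exact: nbhs_left_gt|exact: nbhs_left_lt].
Unshelve. all: by end_near. Qed.

(** A field that is continuous for times in [J] only becomes continuous for
    all times when time is first projected to [J]. *)
Lemma continuous_on_times_clamp {J : set R} {f : field R d} {tau : R -> R} :
  continuous_on_times J f -> continuous tau -> (forall t, J (tau t)) ->
  continuous (on_pairs (fun x t => f x (tau t))).
Proof.
move=> cf ctau Jtau.
apply: (@within_continuous_comp _ _ _ _ (fun z : 'rV[R]_d * R => (z.1, tau z.2)) cf).
  apply: continuous_pairf; first by apply: continuous_fstf; exact: continuous_idf.
  by apply: (continuous_compf ctau); apply: continuous_sndf; exact: continuous_idf.
by move=> z; exact: Jtau.
Qed.

Lemma eq_st_form {w : 'rV[R]_d -> R} {J : set R} {f g1 g2 : field R d} :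
  (forall x t, J t -> g1 x t = g2 x t) -> st_form w J f g1 = st_form w J f g2.
Proof.
move=> E; apply: eq_Rintegral => t; rewrite inE => Jt; congr integral_Rn.
by apply/funext => x; rewrite E.
Qed.
End Extension.

Section Adjoint.
Context {R : realType} {d : nat}.
Variables (T : R) (c rho : 'rV[R]_d -> R) (P : field R d -> field R d).
Hypotheses (T0 : 0 < T) (Hc : forall x, 0 < c x) (cc : continuous c)
  (Hrho : forall x, 0 < rho x) (rho2 : Ck 2 rho) (HP : is_propagation c rho T P).

Section Propagation.
Variables (kappa : R) (w : 'rV[R]_d -> R) (src ps : field R d).
Hypotheses (kappa0 : 0 < kappa) (wE : forall x, w x = kappa * (rho x)^-1).
Hypothesis Hps : adjoint_wavefield c rho T src ps.

Let cw : continuous w.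
Proof.
rewrite (_ : w = fun x => kappa * (rho x)^-1); last exact/funext.
apply: continuous_mulf; first exact: continuous_cstf.
by apply: continuous_invf; [move=> x; rewrite gt_eqF|exact: Ck_continuous rho2].
Qed.

Let w0 x : 0 < w x. Proof. by rewrite wE mulr_gt0// invr_gt0. Qed.

(* The clamp makes the field continuous for all times; since ps x 0 = 0, it
   vanishes from time T on. *)
Let reversed : field R d := fun x t => ps x (Num.max 0 (T - t)).

Lemma reversed_continuous : continuous (on_pairs reversed).
Proof.
have [ps2 _ _] := Hps.
apply: (continuous_on_pairs_app (Ck_continuous ps2)).
  by apply: continuous_fstf; exact: continuous_idf.
apply: (continuous_maxf (continuous_cstf 0)).
by apply: continuous_subf; [exact: continuous_cstf|apply: continuous_sndf;
    exact: continuous_idf].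
Qed.

Lemma reversedE x t : (t <= T -> reversed x t = ps x (T - t)) /\
  (T <= t -> reversed x t = 0).
Proof.
have [_ _ ps0] := Hps; rewrite /reversed; split => h.
  by rewrite max_r// subr_ge0.
by rewrite max_l ?subr_le0//; have [] := ps0 x.
Qed.

Lemma st_form_reversed {S : field R d} : C0infty_pos S ->
  st_form w `]0, +oo[ S reversed = st_form w `[0, T] S (fun x t => ps x (T - t)).
Proof.
move=> /C0infty_posW CS; have [M M0 HM] := C0infty_vanish CS.
have cF : continuous (fun t => box_integral M d (fun x => S x t * reversed x t * w x)).
  apply: box_field_continuous; apply: continuous_weighted cw (C0infty_continuous CS) _.
  exact: reversed_continuous.
rewrite (st_form_box HM) (@Rintegral_sub_support _ _ `]0, T]); last 2 first.
- by move=> t /=; rewrite !in_itv/= andbT => /andP[].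
- move=> t /=; rewrite !in_itv/= andbT => t0 /negP; rewrite t0/= -ltNge => /ltW tT.
  by apply: (io_eq0 (box_integralP M d)) => x _;
      rewrite (reversedE x t).2// mulr0 mul0r.
rewrite Rintegral_itv_obnd_cbnd; last first.
  apply: integrableS (continuous_integrable 0 T cF) => //.
  by move=> t /=; rewrite !in_itv/= => /andP[/ltW -> ->].
rewrite -(st_form_box HM); apply: eq_st_form => x t /=; rewrite in_itv/= => /andP[_ tT].
exact: (reversedE x t).1.
Qed.

(** Green identity on [0, T]; after T the reversed field vanishes. *)
Lemma propagation_adjoint_reversed {S : field R d} : C0infty_pos S ->
  st_form w `[0, T] (P S) src = st_form w `]0, +oo[ S reversed.
Proof.
move=> CS; rewrite st_form_reversed//; have [CP wP P0] := HP _ CS.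
exact: (wave_reciprocity T c rho T0 Hc cc Hrho rho2 wE CP wP P0 (C0infty_posW CS) Hps).
Qed.

(** The reversed field is an adjoint image; another continuous one has the
    same pairings with all test sources, and these determine it for positive
    times, hence at time 0 as well. *)
Lemma propagation_adjointP {q : field R d} : continuous_on_times `[0, +oo[ q ->
  is_propagation_adjoint w T P src q <-> is_time_reversal T ps q.
Proof.
move=> cq; split => [Hq|Hq S CS]; last first.
  rewrite propagation_adjoint_reversed//; apply: eq_st_form => x t /=.
  rewrite in_itv/= andbT => t0; have [q1 q2] := Hq x t.
  have [tT|Tt] := leP t T.
    by rewrite (reversedE x t).1// q1// (ltW t0).
  by rewrite (reversedE x t).2 ?(ltW Tt)// q2.
(* q is continuous for nonnegative times only. *)
pose qp : field R d := fun x t => q x (Num.max 0 t).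
have cqp : continuous (on_pairs qp).
  apply: (continuous_on_times_clamp cq).
    exact: (continuous_maxf (continuous_cstf 0) continuous_idf).
  by move=> t /=; rewrite in_itv/= andbT le_max lexx.
have qpos x t : 0 < t -> qp x t = reversed x t.
  move=> t0; have e0 : 0 < t / 2 by rewrite divr_gt0.
  apply: (@st_form_separates R d w `]0, +oo[ cw w0 qp reversed x t (t / 2) cqp
    reversed_continuous e0).
    by move=> s /andP[h _]; rewrite /= in_itv/= andbT; lra.
  move=> e /andP[ep et].
  have CS : C0infty_pos (test_bump e x t) by apply: C0infty_pos_test_bump; lra.
  rewrite -propagation_adjoint_reversed// Hq//; apply: eq_st_form => z s /=.
  by rewrite in_itv/= andbT => s0; rewrite /qp max_r ?(ltW s0).
have slice (g : field R d) x : continuous (on_pairs g) -> continuous (fun t => g x t).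
  by move=> cg; exact: (continuous_on_pairs_app cg (continuous_cstf x) continuous_idf).
have qge0 x t : 0 <= t -> q x t = reversed x t.
  move=> t0; have -> : q x t = qp x t by rewrite /qp max_r.
  move: t0; rewrite le_eqVlt => /predU1P[<-|]; last exact: qpos.
  have [] // := continuous_eq_ends ltr01 (slice _ x cqp)
      (slice _ x reversed_continuous).
  by move=> s /andP[s0 _]; exact: qpos.
move=> x t; split => [/andP[t0 tT]|Tt].
  by rewrite qge0// (reversedE x t).1.
by rewrite qge0 ?(reversedE x t).2 ?(ltW Tt)// (le_trans (ltW T0))// ltW.
Qed.
End Propagation.

Section Action.
Context {I : finType}.
Variables (k : bc_type) (b : R) (Omega : set 'rV[R]_d) (r : I -> receiver R d)
  (A : {set I}) (y : I -> field R d) (src src0 : field R d).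
Hypothesis Hsrc : is_reception_adjoint k rho b T Omega r A y src.
Hypotheses (csrc0 : continuous (on_pairs src0))
  (srcE : forall x t, 0 <= t <= T -> src x t = src0 x t).

(** Bumps supported in ]0, T[ determine a field for interior times, and
    continuity determines it at the two ends. *)
Lemma reception_adjoint_unique {h : field R d} : continuous_on_times `[0, T] h ->
  is_reception_adjoint k rho b T Omega r A y h ->
  forall x t, 0 <= t <= T -> h x t = src x t.
Proof.
move=> ch Hh; pose clamp t := Num.max 0 (Num.min T t).
have clampE t : 0 <= t <= T -> clamp t = t.
  by move=> /andP[t0 tT]; rewrite /clamp min_r// max_r.
pose hc : field R d := fun x t => h x (clamp t).
have chc : continuous (on_pairs hc).
  apply: (continuous_on_times_clamp ch).
    move=> t; apply: (continuous_maxf (continuous_cstf 0)) => {}t.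
    by apply: continuous_min; [exact: cvg_cst|exact: cvg_id].
  move=> t /=; rewrite in_itv/= /clamp le_max lexx /= ge_max (ltW T0) /=.
  by rewrite ge_min lexx.
have inner x t : 0 < t < T -> hc x t = src0 x t.
  move=> /andP[t0 tT]; have e0 : 0 < Num.min t (T - t) by rewrite lt_min t0 subr_gt0.
  have et : Num.min t (T - t) <= t by rewrite ge_min lexx.
  have eT : Num.min t (T - t) <= T - t by rewrite ge_min lexx orbT.
  have c1 : continuous (cst 1 : 'rV[R]_d -> R) by exact: continuous_cstf.
  have p1 (z : 'rV[R]_d) : 0 < cst 1 z :> R by rewrite /cst ltr01.
  apply: (@st_form_separates R d (cst 1) `[0, T] c1 p1 hc src0 x t _ chc csrc0 e0).
  - by move=> s /andP[s1 s2]; rewrite /= in_itv/=; apply/andP; split; lra.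
  move=> e _; have CS := C0infty_test_bump e x t.
  transitivity (st_form (cst 1) `[0, T] (test_bump e x t) h).
    by apply: eq_st_form => z s /=; rewrite in_itv/= => sT; rewrite /hc clampE.
  rewrite -Hh// Hsrc//; apply: eq_st_form => z s /=; rewrite in_itv/=; exact: srcE.
have slice (g : field R d) x : continuous (on_pairs g) -> continuous (fun t => g x t).
  by move=> cg; exact: (continuous_on_pairs_app cg (continuous_cstf x) continuous_idf).
move=> x t tT; rewrite srcE//; have -> : h x t = hc x t by rewrite /hc clampE.
have [H0 HT] := continuous_eq_ends T0 (slice _ x chc) (slice _ x csrc0) (inner x).
move: tT => /andP[]; rewrite le_eqVlt => /predU1P[<- _//|t0].
rewrite le_eqVlt => /predU1P[->//|tT].
by apply: inner; rewrite t0.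
Qed.

Lemma composed_adjointP {kappa : R} {w : 'rV[R]_d -> R} {ps q : field R d} :
  0 < kappa -> (forall x, w x = kappa * (rho x)^-1) ->
  adjoint_wavefield c rho T src ps -> continuous_on_times `[0, +oo[ q ->
  is_composed_adjoint w k rho b T Omega P r A y q <-> is_time_reversal T ps q.
Proof.
move=> k0 wE Hps cq; rewrite -(propagation_adjointP _ _ _ _ k0 wE Hps cq); split.
  move=> [h [ch Hh Hq]] S CS; rewrite -Hq//; apply: eq_st_form => x t /=.
  by rewrite in_itv/= => tT; rewrite (reception_adjoint_unique ch Hh).
move=> Hq; exists src; split => //.
have : {within [set z : 'rV[R]_d * R | (`[0, T]%classic :
    set R) z.2], continuous (on_pairs src0)}.
  exact: continuous_subspaceT.
apply: subspace_eq_continuous => -[x t]; rewrite inE /= in_itv/= => tT.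
by apply/esym; exact: srcE.
Qed.

(** The forward form differs from the propagation form only by the reception
    duality, so for constant rho both equivalences follow from the same one
    with weight 1 = rho (1 / rho). *)
Lemma adjoint_action : adjoint_action_formula k c rho b T Omega P r A y src.
Proof.
move=> ps Hps q cq; split.
  by apply: (composed_adjointP ltr01) => // x; rewrite mul1r.
move=> rho_cst.
have k0 : 0 < rho 0 by [].
have wE x : cst 1 x = rho 0 * (rho x)^-1 :> R by rewrite (rho_cst 0 x) divff// gt_eqF.
split; last exact: (composed_adjointP k0 wE).
rewrite -(propagation_adjointP _ _ _ _ k0 wE Hps cq).
by split => H S CS; [rewrite -H// Hsrc//|rewrite -H// Hsrc//]; have [] := HP _ CS.
Qed.
End Action.
End Adjoint.

(** The pairings of the single receivers are added; the continuity of each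
    source allows the sum to pass under the integrals. *)
Lemma reception_adjoint_sum {R : realType} {d : nat} {T b : R} {rho : 'rV[R]_d -> R}
    {Omega : set 'rV[R]_d} {I : finType} {r : I -> receiver R d} {k : bc_type}
    {y : I -> field R d} (src0 : I -> field R d) :
  (forall x, 0 < rho x) -> Ck 2 rho -> (forall i, is_receiver b Omega (r i)) ->
  (forall i, C0infty_bdry T Omega (scale_inv (r i) (y i))) ->
  (forall i, continuous (on_pairs (src0 i)) /\ forall x t, 0 <= t <= T ->
     adjoint_source k rho b Omega (r i) (y i) x t = src0 i x t) ->
  is_reception_adjoint k rho b T Omega r [set: I]%SET y
      (total_source k rho b Omega r y).
Proof.
move=> Hrho rho2 Hr Hy H0 f Cf.
have [M M0 HM] := C0infty_vanish Cf; have cf := C0infty_continuous Cf.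
have HB := box_integralP M d; have HI := interval_integralP 0 T.
have c1 : continuous (cst 1 : 'rV[R]_d -> R) by exact: continuous_cstf.
have cfi i := continuous_weighted c1 cf (H0 i).1.
rewrite /scaled_pairing.
transitivity (\sum_i interval_integral 0 T (fun t =>
    box_integral M d (fun x => f x t * src0 i x t * cst 1 x))).
  apply: eq_big => i; first by rewrite inE.
  move=> _; rewrite (reception_duality T b rho Omega (r i) Hrho rho2 (Hr i) k
      (Hy i) Cf).
  rewrite -[RHS](st_form_box HM); apply: eq_st_form => x t /=; rewrite in_itv/=.
  exact: (H0 i).2.
rewrite (st_form_box HM) -(io_sum HI); last by move=> i; exact: box_field_continuous.
apply: (io_local HI) => t; rewrite /= in_itv/= => tT.
rewrite -(io_sum HB); last by move=> i; exact: (on_pairs_slice t (cfi i)).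
apply: (io_local HB) => x _; rewrite /total_source mulr_sumr mulr_suml.
by apply: eq_bigr => i _; rewrite (H0 i).2.
Qed.

Theorem lemma7 (R : realType) (d : nat) (Hd : d = 2%N \/ d = 3%N)
  (T b : R) (HT : 0 < T) (Hb : 0 < b)
  (c rho0 : 'rV[R]_d -> R)
  (Hc : forall x, 0 < c x) (Hc_cont : continuous c)
  (Hrho : forall x, 0 < rho0 x) (Hrho_C2 : Ck 2 rho0)
  (Omega : set 'rV[R]_d)
  (HOmega : [/\ open Omega, connected Omega & Omega !=set0])
  (P : field R d -> field R d) (HP : is_propagation c rho0 T P)
  (I : finType) (r : I -> receiver R d)
  (Hr : forall i, is_receiver b Omega (r i))
  (k : bc_type) (y : I -> field R d)
  (Hy : forall i, C0infty_bdry T Omega (scale_inv (r i) (y i))) :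
  (forall i : I,
     adjoint_action_formula k c rho0 b T Omega P r [set i]%SET y
       (adjoint_source k rho0 b Omega (r i) (y i))) /\
  adjoint_action_formula k c rho0 b T Omega P r [set: I]%SET y
    (total_source k rho0 b Omega r y).
Proof.
have /choice[src0 H0] : forall i, exists h : field R d, continuous (on_pairs h) /\
    forall x t, 0 <= t <= T -> adjoint_source k rho0 b Omega (r i) (y i) x t = h x t.
  move=> i; have [h ch hE] :=
    adjoint_source_extension T b rho0 Omega (r i) Hrho Hrho_C2 (Hr i) k (Hy i).
  by exists h.
split => [i|].
  apply: (adjoint_action T c rho0 P HT Hc Hc_cont Hrho Hrho_C2 HP k b Omega r _ y _
    (src0 i) _ (H0 i).1 (H0 i).2) => f Cf.
  rewrite /scaled_pairing big_set1.
  exact: (reception_duality T b rho0 Omega (r i) Hrho Hrho_C2 (Hr i) k (Hy i) Cf).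
apply: (adjoint_action T c rho0 P HT Hc Hc_cont Hrho Hrho_C2 HP k b Omega r _ y _
  (fun x t => \sum_i src0 i x t)).
- exact: (reception_adjoint_sum src0 Hrho Hrho_C2 Hr Hy H0).
- by apply: continuous_sumf => i; exact: (H0 i).1.
- by move=> x t tT; apply: eq_bigr => i _; exact: (H0 i).2.
Qed.
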